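(* Let $n>0$ be a real number. Then $$\int_0^{\infty}\frac{\sin(nx)}{x^2+1}\,dx+\frac{2}{\pi}\int_0^{\infty}\frac{\cos(nx)}{x^2+1}\log x\,dx=0$$ and $$\int_0^{\infty}\frac{\sin(nx)\log x}{x^2+1}\,dx+\frac{1}{\pi}\int_0^{\infty}\frac{\cos(nx)\log^2x}{x^2+1}\,dx=\frac{\pi^2e^{-n}}{8}.$$
   Context: Here $\log$ is the natural logarithm and $\log^2 x=(\log x)^2$. *)

(* Defs.v *)
From HB Require Import structures.
From mathcomp Require Import all_boot all_order all_algebra.
From mathcomp Require Import all_classical all_reals all_analysis.

(* All integrals are Lebesgue integrals over ]0, +oo[; each integrand is
   absolutely integrable there, so they agree with the improper Riemann
   integrals.  The identities are equations in \bar R between extended-real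
   integrals: since oo - oo = -oo in \bar R, an equation with a finite
   right-hand side also asserts that every integral in it converges. *)

(* Main.v *)
Require Import Defs.
From HB Require Import structures.
From mathcomp Require Import all_boot all_order all_algebra.
From mathcomp Require Import all_classical all_reals all_analysis.
From mathcomp Require Import measurable_realfun.
From mathcomp Require Import ring lra.
Set Implicit Arguments.
Unset Strict Implicit.
Unset Printing Implicit Defensive.
Import Order.TTheory GRing.Theory Num.Theory.
Local Open Scope classical_set_scope.
Local Open Scope ring_scope.
Import numFieldNormedType.Exports.

(** Why the identities hold.  Let S_k and C_k be the sine and cosine transforms,
as functions of the frequency t > 0, of the weights ln^k x / (x^2 + 1) on
]0, +oo[.  The claims are S_0 + (2/pi) C_1 = 0 and
S_1 + (1/pi) C_2 = (pi^2/8) e^-t.  Both sides are bounded and continuous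
in t, so it is enough that their Laplace transforms agree at the integers
p >= 2 ([laplace_unique]).

By Fubini the Laplace transform of S_k (resp. C_k) at p is the integral of
the weight against x / (x^2 + p^2) (resp. p / (x^2 + p^2)).  All the oscillation
has disappeared, and four rational-logarithmic integrals remain.  They are
expressed through J(p) = ln p / (p^2 - 1):
- S_0 gives J(p), by partial fractions ([integral_J_kernel]);
- S_1 gives (ln p / 2) J(p), because x -> p / x sends the integral I to
  ln p J(p) - I ([integral_xln]);
- C_1 gives - (pi/2) J(p) and C_2 gives c / (p + 1) - (pi/2) ln p J(p), by
  partial fractions and the same inversion, where c is the integral of
  ln^2 x / (x^2 + 1) ([integral_cos_ln], [integral_cos_ln2]).
The first identity follows at once, and the second one as soon as
c = pi^3 / 8 ([integral_ln2]).

The constant c comes from Tonelli's theorem.  After x = e^u the functions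
1 / (x^2 + 1), J and its transform
  P(y) = int_0^oo p J(p) / (p^2 + y^2) dp
are, up to elementary factors, the convolution powers of order 1, 2 and 3 of
1 / cosh u.  Hence the integrals of J and of P are products, pi^2 / 4 and
pi^3 / 8.  On the other hand P is explicit:
(y^2 + 1) P(y) = ln^2 y / 2 + pi^2 / 8.  Integrating P(y) over y therefore
computes c. *)

(** * Derivation rules *)

Section derivatives.
Context {R : realType}.
Implicit Types f F g : R -> R.

(** Unlike [is_derive], this is not a type class: the side conditions of the
rules below (a nonzero denominator, a positive argument of [ln]) are left as
goals instead of being searched for by instance resolution. *)
Definition has_derivative (F : R -> R) (x d : R) := is_derive x (1 : R) F d.

Lemma has_derivative_eq F x d d' :
  has_derivative F x d -> d = d' -> has_derivative F x d'.
Proof. by move=> ? <-. Qed.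

Section derivation_rules.
Variables (f g : R -> R) (x a b : R).
Hypotheses (df : has_derivative f x a) (dg : has_derivative g x b).

Lemma has_derivative_continuous : {for x, continuous f}.
Proof. by apply/differentiable_continuous/derivable1_diffP; have [] := df. Qed.

Lemma has_derivativeD : has_derivative (fun y => f y + g y) x (a + b).
Proof. exact: is_deriveD. Qed.

Lemma has_derivativeN : has_derivative (fun y => - f y) x (- a).
Proof. exact: is_deriveN. Qed.

Lemma has_derivativeM : has_derivative (fun y => f y * g y) x (a * g x + f x * b).
Proof.
have /is_derive_eq := @is_deriveM _ _ f g x 1 a b df dg; apply.
by rewrite /GRing.scale/= addrC [g x * a]mulrC.
Qed.

Lemma has_derivativeX n :
  has_derivative (fun y => f y ^+ n) x (n%:R * f x ^+ n.-1 * a).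
Proof.
have := @is_deriveX _ _ f n x 1 a df.
by rewrite /has_derivative /GRing.scale/=; congr is_derive; apply/funext => y;
  rewrite fctE.
Qed.

Lemma has_derivativeV : f x != 0 ->
  has_derivative (fun y => (f y)^-1) x (- a / (f x) ^+ 2).
Proof.
move=> fx0; have /is_derive_eq := @is_deriveV _ f x a 1 fx0 df; apply.
by rewrite /GRing.scale/= !mulNr mulrC.
Qed.

Lemma has_derivative_expR : has_derivative (fun y => expR (f y)) x (expR (f x) * a).
Proof. exact: (is_derive1_comp (is_derive_expR _) df). Qed.

Lemma has_derivative_sin : has_derivative (fun y => sin (f y)) x (cos (f x) * a).
Proof. exact: (is_derive1_comp (is_derive_sin _) df). Qed.

Lemma has_derivative_cos : has_derivative (fun y => cos (f y)) x (- sin (f x) * a).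
Proof. exact: (is_derive1_comp (is_derive_cos _) df). Qed.

Lemma has_derivative_atan :
  has_derivative (fun y => atan (f y)) x ((1 + f x ^+ 2)^-1 * a).
Proof. exact: (is_derive1_comp (is_derive1_atan _) df). Qed.

Lemma has_derivative_ln : 0 < f x ->
  has_derivative (fun y => ln (f y)) x ((f x)^-1 * a).
Proof. move=> fx0; exact: (is_derive1_comp (is_derive1_ln fx0) df). Qed.

End derivation_rules.

Lemma has_derivative_id (x : R) : has_derivative (fun y => y) x 1.
Proof. exact: is_derive_id. Qed.

Lemma has_derivative_cst (c x : R) : has_derivative (fun=> c) x 0.
Proof. exact: is_derive_cst. Qed.

End derivatives.

(** The first five cases undo eta-reductions, which unification introduces
when it instantiates the functions of a rule. *)
Ltac derive_rules := lazymatch goal with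
  | |- has_derivative ( *%R ?c) ?x ?d => change (has_derivative (fun y => c * y) x d); derive_rules
  | |- has_derivative (+%R ?c) ?x ?d => change (has_derivative (fun y => c + y) x d); derive_rules
  | |- has_derivative (@ln ?K) ?x ?d => change (has_derivative (fun y : K => ln y) x d); derive_rules
  | |- has_derivative (@GRing.inv ?K) ?x ?d => change (has_derivative (fun y : K => y^-1) x d); derive_rules
  | |- has_derivative (-%R) ?x ?d => change (has_derivative (fun y => - y) x d); derive_rules
  | |- has_derivative (fun y => y) _ _ => exact: has_derivative_id
  | |- has_derivative (fun _ => ?c) _ _ => exact: has_derivative_cst
  | |- has_derivative (fun _ => - _) _ _ => apply: has_derivativeN; derive_rules
  | |- has_derivative (fun _ => _ + _) _ _ => apply: has_derivativeD; derive_rules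
  | |- has_derivative (fun _ => _ * _) _ _ => apply: has_derivativeM; derive_rules
  | |- has_derivative (fun _ => _ ^+ _) _ _ => apply: has_derivativeX; derive_rules
  | |- has_derivative (fun _ => _^-1) _ _ => apply: has_derivativeV; [derive_rules|]
  | |- has_derivative (fun _ => expR _) _ _ => apply: has_derivative_expR; derive_rules
  | |- has_derivative (fun _ => sin _) _ _ => apply: has_derivative_sin; derive_rules
  | |- has_derivative (fun _ => cos _) _ _ => apply: has_derivative_cos; derive_rules
  | |- has_derivative (fun _ => atan _) _ _ => apply: has_derivative_atan; derive_rules
  | |- has_derivative (fun _ => ln _) _ _ => apply: has_derivative_ln; [derive_rules|]
  | |- _ => idtac
  end.

(** * Elementary integrals over the half line *)

Section elementary_integrals.
Context {R : realType}.
Local Notation mu := (@lebesgue_measure R).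
Local Notation D := (`]0%R, +oo[%classic : set R).
Implicit Types f F g : R -> R.

(** Nonnegativity of [f] makes the improper integral a monotone limit, so that
a finite limit of the primitive also proves convergence. *)
Lemma FTC_half_line f F (l : R) :
  (forall x : R, 0 <= x -> 0 <= f x) ->
  (forall x : R, 0 <= x -> {for x, continuous f}) ->
  (forall x : R, 0 <= x -> has_derivative F x (f x)) ->
  F x @[x --> +oo%R] --> l ->
  (\int[mu]_(x in D) (f x)%:E = (l - F 0)%:E)%E.
Proof.
move=> f0 cf dF Fl.
have cF x : 0 <= x -> {for x, continuous F}.
  by move=> x0; exact: has_derivative_continuous (dF x x0).
have cf0 : {within `[0, +oo[, continuous f}.
  apply/continuous_within_itvcyP; split.
    by move=> x; rewrite in_itv/= andbT => x0; exact/cf/ltW.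
  by apply: cvg_at_right_filter; exact: cf.
rewrite integral_itv_obnd_cbnd; last first.
  apply/measurable_EFinP; apply: open_continuous_measurable_fun => //.
  by move=> x; rewrite inE/= in_itv/= andbT => x0; exact/cf/ltW.
rewrite (ge0_continuous_FTC2y f0 cf0 Fl)//.
- by move=> x x0; have [] := dF x (ltW x0).
- by apply: cvg_at_right_filter; exact: cF.
- move=> x; rewrite in_itv/= andbT => x0; rewrite derive1E.
  by have [_ ->] := dF x (ltW x0).
Qed.

Lemma measurable_invr : measurable_fun [set: R] (@GRing.inv R).
Proof.
rewrite -(setvU [set 0 : R]); apply/measurable_funU => //.
  exact: measurableC.
split.
  apply: open_continuous_measurable_fun; first exact: closed_openC.
  move=> x; rewrite inE/= => x0; apply: inv_continuous; exact/eqP.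
exact: measurable_fun_set1.
Qed.

Lemma measurable_funV d (T : measurableType d) (A : set T) (f : T -> R) :
  measurable_fun A f -> measurable_fun A (fun x => (f x)^-1).
Proof. by move=> mf; apply: measurableT_comp => //; exact: measurable_invr. Qed.

Lemma measurable_fun_div d (T : measurableType d) (A : set T) (f g : T -> R) :
  measurable_fun A f -> measurable_fun A g ->
  measurable_fun A (fun x => f x / g x).
Proof. by move=> mf mg; apply: measurable_funM => //; exact: measurable_funV. Qed.

Lemma integral_inv_sqrD (a : R) : 0 < a ->
  (\int[mu]_(x in D) ((x ^+ 2 + a ^+ 2)^-1)%:E = (pi / (2 * a))%:E)%E.
Proof.
move=> a0.
have a1 := lt0r_neq0 a0.
have xa (x : R) : x ^+ 2 + a ^+ 2 != 0.
  by rewrite gt_eqF// ltr_wpDl ?sqr_ge0// exprn_gt0.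
rewrite (@FTC_half_line _ (fun x => atan (x / a) / a) (pi / 2 / a)).
- by rewrite mul0r atan0 mul0r subr0 invfM mulrA.
- by move=> x x0; rewrite invr_ge0 addr_ge0// sqr_ge0.
- by move=> x x0; apply: has_derivative_continuous; derive_rules.
- move=> x x0; apply: has_derivative_eq; first by derive_rules.
  by rewrite /=; field; rewrite xa a1.
- apply: cvgM; last exact: cvg_cst.
  apply: (@cvg_comp _ _ _ (fun x => x / a) atan _ +oo%R); last exact: cvgy_atan.
  by apply: gt0_cvgMly => //; rewrite invr_gt0.
Qed.

Lemma cvgy_sqrDV (a : R) : 0 < a -> (x ^+ 2 + a)^-1 @[x --> +oo%R] --> (0 : R).
Proof.
move=> a0; apply/gtr0_cvgV0.
  by near=> x; rewrite ltr_wpDl ?sqr_ge0.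
apply/cvgryPge => A; have /cvgryPge/(_ A) := @cvgr_expr2 R.
by apply: filterS => x Ax; rewrite ler_wpDr// ltW.
Unshelve. all: by end_near. Qed.

Lemma cvgy_addV (a : R) : (x + a)^-1 @[x --> +oo%R] --> (0 : R).
Proof.
apply/gtr0_cvgV0.
  by near=> x; rewrite -ltrBlDr sub0r; near: x; apply: nbhs_pinfty_gt;
    exact: num_real.
by apply/cvgryPge => A; near=> x; rewrite -lerBlDr; near: x; apply: nbhs_pinfty_ge;
  exact: num_real.
Unshelve. all: by end_near. Qed.

Lemma cvgy_expRM (p : R) : 0 < p -> expR (- (p * t)) @[t --> +oo%R] --> (0 : R).
Proof.
move=> p0; apply: (@cvg_comp _ _ _ (fun x => p * x) (fun x => expR (- x)) _ +oo%R).
  by apply: gt0_cvgMry.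
exact: cvgr_expR.
Qed.

Lemma integral_expR (p : R) : 0 < p ->
  (\int[mu]_(t in D) (expR (- (p * t)))%:E = (p^-1)%:E)%E.
Proof.
move=> p0; have p1 := lt0r_neq0 p0.
rewrite (@FTC_half_line _ (fun t => - expR (- (p * t)) / p) (- 0 / p)).
- by rewrite mulr0 !oppr0 expR0 mul0r mulNr opprK add0r mul1r.
- by move=> x x0; exact: expR_ge0.
- by move=> x x0; apply: has_derivative_continuous; derive_rules.
- move=> x x0; apply: has_derivative_eq; first by derive_rules.
  by rewrite /=; field.
- by apply: cvgM; [apply: cvgN; exact: cvgy_expRM|exact: cvg_cst].
Qed.

(** The summand 1 makes the integrand nonnegative, which brings the oscillating
integral within reach of [FTC_half_line]; its contribution [p^-1] is
subtracted in [integral_expR_T]. *)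
Lemma integral_expR_trig (p x a b : R) (T : R -> R) : 0 < p ->
  (forall y, T y = a * cos y + b * sin y) -> (forall y, `|T y| <= 1) ->
  (\int[mu]_(t in D) (expR (- (p * t)) * (1 + T (t * x)))%:E =
   (p^-1 + (p * a + x * b) / (x ^+ 2 + p ^+ 2))%:E)%E.
Proof.
move=> p0 TE T1; have p1 := lt0r_neq0 p0.
have xp : x ^+ 2 + p ^+ 2 != 0.
  by rewrite gt_eqF// ltr_wpDl ?sqr_ge0// exprn_gt0.
rewrite (@FTC_half_line _ (fun t => expR (- (p * t)) *
  (- p^-1 + (((- p * a - x * b) * cos (t * x) + (x * a - p * b) * sin
    (t * x))) / (x ^+ 2 + p ^+ 2))) 0).
- rewrite mulr0 mul0r oppr0 expR0 sin0 cos0; congr EFin; field.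
  by rewrite p1 xp.
- move=> t t0; rewrite mulr_ge0 ?expR_ge0//.
  by have := T1 (t * x); rewrite ler_norml => /andP[+ _]; lra.
- move=> t t0; rewrite (_ : (fun t => _) = fun t => expR (- (p * t)) *
      (1 + (a * cos (t * x) + b * sin (t * x)))); last by apply/funext => y;
        rewrite TE.
  by apply: has_derivative_continuous; derive_rules.
- move=> t t0; apply: has_derivative_eq; first by derive_rules.
  by rewrite /= TE; field; rewrite p1 xp.
(* The primitive tends to 0 because it is e^-pt times a bounded function. *)
- pose C := p^-1 + (`|- p * a - x * b| + `|x * a - p * b|) / (x ^+ 2 + p ^+ 2).
  apply/norm_cvg0P.
  have eC : expR (- (p * t)) * C @[t --> +oo%R] --> (0 : R).
    by rewrite -(mul0r C); apply: cvgM; [exact: cvgy_expRM|exact: cvg_cst].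
  apply: (squeeze_cvgr _ (cvg_cst 0) eC).
  near=> t; rewrite normr_ge0/= normrM ger0_norm ?expR_ge0// ler_wpM2l ?expR_ge0//.
  rewrite (le_trans (ler_normD _ _))// lerD//.
    by rewrite normrN ger0_norm// invr_ge0 ltW.
  rewrite normrM (ger0_norm (_ : 0 <= (_ + _)^-1)); last first.
    by rewrite invr_ge0 addr_ge0 ?sqr_ge0.
  rewrite ler_wpM2r ?invr_ge0 ?addr_ge0 ?sqr_ge0// (le_trans (ler_normD _ _))//.
  rewrite lerD// normrM ler_piMr// ler_norml.
    by rewrite cos_geN1 cos_le1.
  by rewrite sin_geN1 sin_le1.
Unshelve. all: by end_near. Qed.

(** The primitive is a multiple of the logarithm of (x^2 + 1) / (x^2 + b), a
quotient written as 1 + (1 - b) / (x^2 + b) to make its limit 1 visible. *)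
Lemma integral_sqr_kernel_neq1 (b : R) : 0 < b -> b != 1 ->
  (\int[mu]_(x in D) (x / ((x ^+ 2 + b) * (x ^+ 2 + 1)))%:E =
    (ln b / (2 * (b - 1)))%:E)%E.
Proof.
move=> b0 bneq1; have bne0 := lt0r_neq0 b0.
have b1 : b - 1 != 0 by rewrite subr_eq0.
have xb (x : R) : 0 < x ^+ 2 + b by rewrite ltr_wpDl ?sqr_ge0.
have x1 (x : R) : 0 < x ^+ 2 + 1 by rewrite ltr_wpDl ?sqr_ge0.
have E (x : R) : 1 + (1 - b) * (x ^+ 2 + b)^-1 = (x ^+ 2 + 1) / (x ^+ 2 + b).
  by field; exact: lt0r_neq0.
have E0 (x : R) : 0 < 1 + (1 - b) * (x ^+ 2 + b)^-1 by rewrite E divr_gt0.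
rewrite (@FTC_half_line _ (fun x => ln
  (1 + (1 - b) * (x ^+ 2 + b)^-1) / (2 * (b - 1))) 0).
- by rewrite E expr0n !add0r mul1r lnV// mulNr opprK.
- by move=> x x0; rewrite divr_ge0// mulr_ge0// ltW.
- move=> x x0; apply: has_derivative_continuous; derive_rules.
  by apply: mulf_neq0; exact: lt0r_neq0.
- move=> x x0; apply: has_derivative_eq; first by derive_rules =>
  //; exact: lt0r_neq0.
  rewrite /= E; field.
  by rewrite b1 !lt0r_neq0.
- rewrite -(mul0r (2 * (b - 1))^-1); apply: cvgM; last exact: cvg_cst.
  have -> : 0 = ln (1 + (1 - b) * 0) :> R by rewrite mulr0 addr0 ln1.
  apply: continuous_cvg; first by apply: continuous_ln; rewrite mulr0 addr0.
  apply: cvgD; first exact: cvg_cst.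
  apply: cvgM; first exact: cvg_cst.
  exact: cvgy_sqrDV.
Qed.

Lemma integral_sqr_kernel1 :
  (\int[mu]_(x in D) (x / ((x ^+ 2 + 1) * (x ^+ 2 + 1)))%:E = (2^-1 : R)%:E)%E.
Proof.
have x1 (x : R) : 0 < x ^+ 2 + 1 by rewrite ltr_wpDl ?sqr_ge0.
rewrite (@FTC_half_line _ (fun x => - 2^-1 * (x ^+ 2 + 1)^-1) (- 2^-1 * 0)).
- by rewrite expr0n add0r invr1 mulr0 mulr1 add0r opprK.
- by move=> x x0; rewrite divr_ge0// mulr_ge0// ltW.
- move=> x x0; apply: has_derivative_continuous; derive_rules.
  by apply: mulf_neq0; exact: lt0r_neq0.
- move=> x x0; apply: has_derivative_eq; first by derive_rules =>
  //; exact: lt0r_neq0.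
  by rewrite /=; field; exact: lt0r_neq0.
- by apply: cvgM; [exact: cvg_cst|exact: cvgy_sqrDV].
Qed.

Lemma integral_lin_kernel_neq1 (t : R) : 0 < t -> t != 1 ->
  (\int[mu]_(s in D) (((s + t) * (s + 1))^-1)%:E = (ln t / (t - 1))%:E)%E.
Proof.
move=> t0 tneq1; have tne0 := lt0r_neq0 t0.
have t1 : t - 1 != 0 by rewrite subr_eq0.
have st (s : R) : 0 <= s -> 0 < s + t by move=> s0; rewrite ltr_wpDl.
have s1 (s : R) : 0 <= s -> 0 < s + 1 by move=> s0; rewrite ltr_wpDl.
have E (s : R) : 0 <= s -> 1 + (1 - t) * (s + t)^-1 = (s + 1) / (s + t).
  by move=> s0; field; exact/lt0r_neq0/st.
rewrite (@FTC_half_line _ (fun s => ln (1 + (1 - t) * (s + t)^-1) / (t - 1)) 0).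
- by rewrite E// !add0r mul1r lnV// mulNr opprK.
- by move=> s s0; rewrite invr_ge0 mulr_ge0// ltW// ?st ?s1.
- move=> s s0; apply: has_derivative_continuous; derive_rules.
  by apply: mulf_neq0; apply: lt0r_neq0; [exact: st|exact: s1].
- move=> s s0; apply: has_derivative_eq.
    by derive_rules; [exact/lt0r_neq0/st|rewrite E// divr_gt0 ?s1 ?st].
  rewrite /= E//; field.
  by rewrite t1 !lt0r_neq0 ?s1 ?st.
- rewrite -(mul0r (t - 1)^-1); apply: cvgM; last exact: cvg_cst.
  have -> : 0 = ln (1 + (1 - t) * 0) :> R by rewrite mulr0 addr0 ln1.
  apply: continuous_cvg; first by apply: continuous_ln; rewrite mulr0 addr0.
  apply: cvgD; first exact: cvg_cst.
  apply: cvgM; first exact: cvg_cst.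
  exact: cvgy_addV.
Qed.

Lemma integral_lin_kernel1 :
  (\int[mu]_(s in D) (((s + 1) * (s + 1))^-1)%:E = (1 : R)%:E)%E.
Proof.
have s1 (s : R) : 0 <= s -> 0 < s + 1 by move=> s0; rewrite ltr_wpDl.
rewrite (@FTC_half_line _ (fun s => - (s + 1)^-1) (- 0)).
- by rewrite add0r invr1 oppr0 add0r opprK.
- by move=> s s0; rewrite invr_ge0 mulr_ge0// ltW// s1.
- move=> s s0; apply: has_derivative_continuous; derive_rules.
  by apply: mulf_neq0; apply: lt0r_neq0; exact: s1.
- move=> s s0; apply: has_derivative_eq; first by derive_rules; exact/lt0r_neq0/s1.
  by rewrite /=; field; exact/lt0r_neq0/s1.
- by apply: cvgN; exact: cvgy_addV.
Qed.

End elementary_integrals.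

(** * The inversion x -> a / x *)

Section substitution.
Context {R : realType}.
Local Notation mu := (@lebesgue_measure R).
Local Notation D := (`]0%R, +oo[%classic : set R).
Implicit Types f F g : R -> R.

Lemma measurable_fun_half_line f : (forall x : R, 0 < x -> {for x, continuous f}) ->
  measurable_fun D f.
Proof.
move=> cf; apply: open_continuous_measurable_fun => //.
by move=> x; rewrite inE/= in_itv/= andbT => x0; exact: cf.
Qed.

Lemma within_segment f (a b : R) : 0 < a -> a <= b -> 
  (forall x : R, 0 < x -> {for x, continuous f}) -> {within `[a, b], continuous f}.
Proof.
move=> a0 ab cf; apply: continuous_in_subspaceT => x.
by rewrite inE/= in_itv/= => /andP[ax _]; apply: cf; exact: lt_le_trans ax.
Qed.

Lemma bigcup_half_line (u v : nat -> R) : (forall n, 0 < u n) ->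
  (forall x, 0 < x -> exists n, u n <= x <= v n) ->
  \bigcup_n `[u n, v n]%classic = D.
Proof.
move=> u0 uv; apply/seteqP; split => x /=.
  move=> [n _ /=]; rewrite !in_itv/= => /andP[unx _].
  by rewrite (lt_le_trans (u0 n)).
rewrite in_itv/= andbT => /uv[n unv].
by exists n => //=; rewrite in_itv.
Qed.

(** The half line is exhausted by the segments [1 / (n + 1), n + 1], to which
the substitution rule for continuous functions on a segment applies; the
last hypothesis says that their images exhaust it as well. *)
Lemma ge0_substitution_decreasing f (phi w : R -> R) :
  (forall x : R, 0 < x -> 0 <= f x) ->
  (forall x : R, 0 < x -> {for x, continuous f}) ->
  (forall x : R, 0 < x -> 0 < phi x) ->
  (forall x y : R, 0 < x -> x < y -> phi y < phi x) ->
  (forall x : R, 0 < x -> has_derivative phi x (- w x)) ->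
  (forall x : R, 0 < x -> {for x, continuous w}) ->
  (forall x : R, 0 < x -> 0 <= w x) ->
  (forall x : R, 0 < x -> exists n : nat, phi n.+1%:R <= x <= phi n.+1%:R^-1) ->
  (\int[mu]_(x in D) (f x)%:E = \int[mu]_(x in D) (f (phi x) * w x)%:E)%E.
Proof.
move=> f0 cf phi0 phi_dec Dphi cw w0 phis.
pose u n : R := n.+1%:R^-1. pose v n : R := n.+1%:R.
have u0 n : 0 < u n by rewrite invr_gt0.
have v0 n : 0 < v n by [].
have uv n : u n <= v n.
  by rewrite (@le_trans _ _ 1)// ?invf_le1// ler1n.
have uvx x : 0 < x -> exists n, u n <= x <= v n.
  move=> x0; pose N := Num.bound (x + x^-1); exists N.
  have xN : x + x^-1 < N%:R.
    by apply: archi_boundP; rewrite addr_ge0// ?invr_ge0 ltW.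
  have NN : N%:R <= v N by rewrite ler_nat.
  apply/andP; split.
    rewrite /u -(invrK x) lef_pV2 ?posrE ?invr_gt0//.
    by apply: le_trans NN; rewrite (le_trans _ (ltW xN))// lerDr ltW.
  by apply: le_trans NN; rewrite (le_trans _ (ltW xN))// lerDl invr_ge0 ltW.
have cphi x : 0 < x -> {for x, continuous phi} by move=> x0;
  exact: has_derivative_continuous (Dphi x x0).
have dE x : 0 < x -> (phi^`())%classic x = - w x.
  by move=> x0; rewrite derive1E; have [_ ->] := Dphi x x0.
have cd x : 0 < x -> {for x, continuous (phi^`())%classic}.
  move=> x0; rewrite /prop_for /continuous_at dE//.
  have : - w y @[y --> x] --> - w x by apply: cvgN; exact: cw.
  apply: cvg_trans; apply: near_eq_cvg; near=> y.
  by rewrite dE//; near: y; exact: lt_nbhsr.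
have ph_le x y : 0 < x -> x <= y -> phi y <= phi x.
  by move=> x0; rewrite le_eqVlt => /predU1P[->//|xy]; exact/ltW/phi_dec.
have E n : (\int[mu]_(x in `[phi (v n), phi (u n)]) (f x)%:E =
    \int[mu]_(x in `[u n, v n]) (f (phi x) * w x)%:E)%E.
  rewrite integration_by_substitution_decreasing//.
  - apply: eq_integral => x; rewrite inE/= in_itv/= => /andP[ux _].
    transitivity ((f (phi x) * - (phi^`())%classic x)%:E) => //.
    by rewrite dE ?opprK// (lt_le_trans (u0 n)).
  - by move=> x y; rewrite !in_itv/= => /andP[ux _] /andP[uy _] yx;
    apply: phi_dec => //;
      exact: lt_le_trans uy.
  - by move=> x; rewrite in_itv/= => /andP[ux _]; apply: cd; exact: lt_trans ux.
  - by apply/cvg_ex; exists (phi^`()%classic (u n)); apply: cvg_at_right_filter;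
    exact: cd.
  - by apply/cvg_ex; exists (phi^`()%classic (v n)); apply: cvg_at_left_filter;
    exact: cd.
  - split.
    + move=> x; rewrite in_itv/= => /andP[ux _].
      by have [] := Dphi x (lt_trans (u0 n) ux).
    + by apply: cvg_at_right_filter; exact: cphi.
    + by apply: cvg_at_left_filter; exact: cphi.
  - by apply: within_segment => //; [exact: phi0|exact: ph_le].
have L : (\int[mu]_(x in `[phi (v n), phi (u n)]) (f x)%:E @[n --> \oo] -->
    \int[mu]_(x in D) (f x)%:E)%E.
  rewrite -(@bigcup_half_line (phi \o v) (phi \o u)); last 2 first.
  - by move=> n; exact: phi0.
  - exact: phis.
  apply: ge0_nondecreasing_set_cvg_integral => //=.
  - apply/nondecreasing_seqP => n; apply/subsetPset => x /=.
    rewrite !in_itv/= => /andP[vx xu]; apply/andP; split.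
      by rewrite (le_trans _ vx)// ph_le// ler_nat.
    by rewrite (le_trans xu)// ph_le// lef_pV2 ?posrE// ler_nat.
  - move=> n; apply/measurable_EFinP.
    apply: measurable_funS (measurable_fun_half_line cf) => //.
    move=> x /=; rewrite !in_itv/= andbT => /andP[+ _].
    by apply: lt_le_trans; exact: phi0.
  - move=> n x; rewrite in_itv/= => /andP[vx _]; rewrite lee_fin f0//.
    by apply: lt_le_trans vx; exact: phi0.
have L' : (\int[mu]_(x in `[u n, v n]) (f (phi x) * w x)%:E @[n --> \oo] -->
    \int[mu]_(x in D) (f (phi x) * w x)%:E)%E.
  rewrite -(@bigcup_half_line u v)//.
  apply: ge0_nondecreasing_set_cvg_integral => //=.
  - apply/nondecreasing_seqP => n; apply/subsetPset => x /=.
    rewrite !in_itv/= => /andP[ux xv]; apply/andP; split.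
      by rewrite (le_trans _ ux)// lef_pV2 ?posrE// ler_nat.
    by rewrite (le_trans xv)// ler_nat.
  - move=> n; apply/measurable_EFinP.
    apply: (@measurable_funS _ _ _ _ D) => //.
      move=> x /=; rewrite !in_itv/= andbT => /andP[+ _].
      exact: lt_le_trans.
    apply: measurable_fun_half_line => x x0; apply: cvgM; last exact: cw.
    by apply: continuous_comp; [exact: cphi|apply: cf; exact: phi0].
  - move=> n x; rewrite in_itv/= => /andP[ux _]; have x0 := lt_le_trans (u0 n) ux.
    by rewrite lee_fin mulr_ge0 ?w0// f0// phi0.
have EE := funext E; rewrite EE in L.
exact: (cvg_unique _ L L').
Unshelve. all: by end_near. Qed.

Lemma ge0_substitution_inv (a : R) f : 0 < a ->
  (forall x : R, 0 < x -> 0 <= f x) ->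
  (forall x : R, 0 < x -> {for x, continuous f}) ->
  (\int[mu]_(x in D) (f x)%:E =
   \int[mu]_(x in D) (f (a / x) * (a / x ^+ 2))%:E)%E.
Proof.
move=> a0 f0 cf; apply: (@ge0_substitution_decreasing _ (fun x => a / x)
   (fun x => a / x ^+ 2)) => //.
- by move=> x x0; rewrite divr_gt0.
- move=> x y x0 xy; have y0 := lt_trans x0 xy.
  by rewrite ltr_pM2l// ltf_pV2.
- move=> x x0; have x1 := lt0r_neq0 x0.
  apply: has_derivative_eq; first by derive_rules.
  by rewrite /=; field.
- move=> x x0; apply: has_derivative_continuous; derive_rules.
  by rewrite expf_neq0// lt0r_neq0.
- by move=> x x0; rewrite ltW// divr_gt0 ?exprn_gt0.
- move=> x x0; pose N := Num.bound (a / x + x / a); exists N.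
  have xN : a / x + x / a < N%:R.
    by apply: archi_boundP; rewrite addr_ge0// divr_ge0// ltW.
  have {}xN : a / x + x / a <= N.+1%:R by rewrite (le_trans (ltW xN))// ler_nat.
  rewrite invrK; apply/andP; split.
    rewrite ler_pdivrMr// mulrC -ler_pdivrMr//.
    by rewrite (le_trans _ xN)// lerDl ltW// divr_gt0.
  rewrite mulrC -ler_pdivrMr//.
  by rewrite (le_trans _ xN)// lerDr ltW// divr_gt0.
Qed.

(** An integral is by definition the difference of those of the positive and the
negative part, and the nonnegative case applies to each. *)
Lemma substitution_inv (a : R) f : 0 < a ->
  (forall x : R, 0 < x -> {for x, continuous f}) ->
  (\int[mu]_(x in D) (f x)%:E = \int[mu]_(x in D) (f (a / x) * (a / x ^+ 2))%:E)%E.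
Proof.
move=> a0 cf; rewrite integralE [RHS]integralE.
have H (g : R -> R) : (forall x : R, 0 < x -> {for x, continuous g}) ->
   (\int[mu]_(x in D) (Num.max (g x) 0)%:E =
     \int[mu]_(x in D) (Num.max (g (a / x) * (a / x ^+ 2)) 0)%:E)%E.
  move=> cg; rewrite (@ge0_substitution_inv a)//.
  - apply: eq_integral => x; rewrite inE/= in_itv/= andbT => x0.
    by rewrite maxr_pMl ?mul0r// divr_ge0 ?exprn_ge0 ?ltW.
  - by move=> x x0; rewrite le_max lexx orbT.
  - by move=> x x0; apply: continuous_max; [exact: cg|exact: cvg_cst].
congr (_ - _)%E.
  under eq_integral do rewrite funeposE -EFin_max.
  under [RHS]eq_integral do rewrite funeposE -EFin_max.
  exact: H.
under eq_integral do rewrite funenegE -EFinN -EFin_max.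
under [RHS]eq_integral do rewrite funenegE -EFinN -EFin_max -mulNr.
by apply: (H (\- f)) => x x0; apply: cvgN; exact: cf.
Qed.

End substitution.

Ltac prove_measurable := lazymatch goal with
  | |- measurable_fun _ (fun _ => ?c) => exact: measurable_cst
  | |- measurable_fun _ (fun _ => _ + _) => apply: measurable_funD; prove_measurable
  | |- measurable_fun _ (fun _ => _ * _) => apply: measurable_funM; prove_measurable
  | |- measurable_fun _ (fun _ => _ ^+ _) => apply: measurable_funX; prove_measurable
  | |- measurable_fun _ (fun _ => - _) => apply: measurable_funN; prove_measurable
  | |- measurable_fun _ (fun _ => _^-1) => apply: measurable_funV; prove_measurable
  | |- measurable_fun _ (fun _ => expR _) => apply: (measurableT_comp (@measurable_expR _)); prove_measurable
  | |- measurable_fun _ (fun _ => ln _) => apply: (measurableT_comp (@measurable_ln _)); prove_measurable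
  | |- measurable_fun _ (fun _ => Num.norm _) => apply: measurableT_comp; [exact: normr_measurable|prove_measurable]
  | |- _ => try by []
  end.

(** * Integrability and iterated integrals on the half line *)

Section iterated.
Context {R : realType}.
Local Notation mu := (@lebesgue_measure R).
Local Notation D := (`]0%R, +oo[%classic : set R).
Implicit Types f F g : R -> R.

Lemma in_half_line (x : R) : (x \in D) = (0 < x).
Proof. by rewrite mem_setE in_itv/= andbT. Qed.

Lemma ge0_integrable f : measurable_fun D f -> (forall x, 0 < x -> 0 <= f x) ->
  (\int[mu]_(x in D) (f x)%:E < +oo)%E -> mu.-integrable D (EFin \o f).
Proof.
move=> mf f0 foo; apply/integrableP; split; first exact/measurable_EFinP.
apply: le_lt_trans foo; rewrite le_eqVlt; apply/orP; left; apply/eqP.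
apply: eq_integral => x; rewrite in_half_line => x0.
by rewrite /= ger0_norm// f0.
Qed.

Lemma dominated_integrable f g : measurable_fun D f ->
  (forall x, 0 < x -> `|f x| <= g x) -> mu.-integrable D (EFin \o g) ->
  mu.-integrable D (EFin \o f).
Proof.
move=> mf fg; apply: le_integrable => //; first exact/measurable_EFinP.
move=> x /=; rewrite in_itv/= andbT => x0; rewrite lee_fin.
by rewrite (le_trans (fg _ x0))// ler_norm.
Qed.

Lemma integral_RintegralE f : mu.-integrable D (EFin \o f) ->
  (\int[mu]_(x in D) (f x)%:E)%E = (\int[mu]_(x in D) f x)%:E.
Proof. by move=> fi; rewrite /Rintegral fineK//; exact: integrable_fin_num. Qed.

(** The theorems of Tonelli and Fubini are about integrals over whole spaces;
extension by zero outside the quadrant reduces to that case. *)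
Lemma iterated_half_line (h : R -> R -> \bar R) :
  (\int[mu]_x \int[mu]_y ((fun z => h z.1 z.2) \_ (D `*` D)) (x, y) =
   \int[mu]_(x in D) \int[mu]_(y in D) h x y)%E.
Proof.
rewrite [RHS]integral_mkcond; apply: eq_integral => x _.
rewrite patchE; case: ifPn => xD.
  rewrite [RHS]integral_mkcond; apply: eq_integral => y _.
  by rewrite !patchE in_setX/= xD.
rewrite integral0_eq// => y _.
by rewrite !patchE in_setX/= (negbTE xD).
Qed.

Lemma iterated_half_line' (h : R -> R -> \bar R) :
  (\int[mu]_y \int[mu]_x ((fun z => h z.1 z.2) \_ (D `*` D)) (x, y) =
   \int[mu]_(y in D) \int[mu]_(x in D) h x y)%E.
Proof.
rewrite [RHS]integral_mkcond; apply: eq_integral => y _.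
rewrite patchE; case: ifPn => yD.
  rewrite [RHS]integral_mkcond; apply: eq_integral => x _.
  by rewrite !patchE in_setX/= yD andbT.
rewrite integral0_eq// => x _.
by rewrite !patchE in_setX/= (negbTE yD) andbF.
Qed.

Section tonelli.
Variable h : R -> R -> R.
Hypothesis mh : measurable_fun [set: R * R] (fun z => h z.1 z.2).
Hypothesis h0 : forall x y, 0 < x -> 0 < y -> 0 <= h x y.

Let hD := ((fun z => (h z.1 z.2)%:E) \_ (D `*` D))%E.

Let mhD : measurable_fun setT hD.
Proof.
apply/(measurable_restrictT (fun z => (h z.1 z.2)%:E)).
  exact: measurableX.
by apply: measurable_funTS; exact/measurable_EFinP.
Qed.

Let hD0 z : (0 <= hD z)%E.
Proof.
apply: erestrict_ge0 => {z} z [] /=; rewrite !in_itv/= !andbT => x0 y0.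
by rewrite lee_fin h0.
Qed.

Lemma tonelli_half_line :
  (\int[mu]_(x in D) \int[mu]_(y in D) (h x y)%:E =
   \int[mu]_(y in D) \int[mu]_(x in D) (h x y)%:E)%E.
Proof.
rewrite -(iterated_half_line (fun x y => (h x y)%:E)).
rewrite -(iterated_half_line' (fun x y => (h x y)%:E)).
exact: fubini_tonelli.
Qed.

(** The form in which Tonelli's theorem is used: both inner integrals are known
in closed form, and the outer ones are thereby equal. *)
Lemma tonelli_half_line_eq F G :
  (forall x : R, 0 < x -> (\int[mu]_(y in D) (h x y)%:E = (F x)%:E)%E) ->
  (forall y : R, 0 < y -> (\int[mu]_(x in D) (h x y)%:E = (G y)%:E)%E) ->
  (\int[mu]_(x in D) (F x)%:E = \int[mu]_(y in D) (G y)%:E)%E.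
Proof.
move=> hF hG.
transitivity (\int[mu]_(x in D) \int[mu]_(y in D) (h x y)%:E)%E.
  by apply: eq_integral => x; rewrite in_half_line => x0; rewrite hF.
rewrite tonelli_half_line; apply: eq_integral => y.
by rewrite in_half_line => y0; rewrite hG.
Qed.

End tonelli.

(** Domination by a product of integrable functions of one variable gives the
integrability on the quadrant. *)
Lemma fubini_half_line (h : R -> R -> R) (m e : R -> R) :
  measurable_fun [set: R * R] (fun z => h z.1 z.2) ->
  measurable_fun [set: R] m -> measurable_fun [set: R] e ->
  (forall x y, 0 < x -> 0 < y -> `|h x y| <= m x * e y) ->
  (forall x, 0 < x -> 0 <= m x) -> (forall y, 0 < y -> 0 <= e y) ->
  mu.-integrable D (EFin \o m) -> mu.-integrable D (EFin \o e) ->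
  (\int[mu]_(x in D) \int[mu]_(y in D) (h x y)%:E =
   \int[mu]_(y in D) \int[mu]_(x in D) (h x y)%:E)%E.
Proof.
move=> mh mm me hme m0 e0 im ie.
rewrite -(iterated_half_line (fun x y => (h x y)%:E)).
rewrite -(iterated_half_line' (fun x y => (h x y)%:E)).
have patch_measurable (k : R -> R -> R) : measurable_fun [set: R * R] (fun z =>
  k z.1 z.2) ->
    measurable_fun setT ((fun z => (k z.1 z.2)%:E) \_ (D `*` D))%E.
  move=> mk; apply/(measurable_restrictT (fun z => (k z.1 z.2)%:E)).
    exact: measurableX.
  by apply: measurable_funTS; exact/measurable_EFinP.
have mme : measurable_fun [set: R * R] (fun z => m z.1 * e z.2).
  by apply: measurable_funM; apply: measurableT_comp.
have ime : (mu \x mu)%E.-integrable setT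
    ((fun z => (m z.1 * e z.2)%:E) \_ (D `*` D))%E.
  apply/integrable12ltyP; first exact: (patch_measurable (fun x y => m x * e y)).
  under eq_integral do under eq_integral do
    rewrite -[(`|_|)%E]/((abse \o _) _) -restrict_abse.
  rewrite (iterated_half_line (fun x y => (`|m x * e y|)%:E)).
  have -> : (\int[mu]_(x in D) \int[mu]_(y in D) (`|m x * e y|)%:E =
      \int[mu]_(x in D) ((m x)%:E * \int[mu]_(y in D) (e y)%:E))%E.
    apply: eq_integral => x; rewrite in_half_line => x0; rewrite -integralZl//.
    apply: eq_integral => y; rewrite in_half_line => y0.
    by rewrite -EFinM ger0_norm// mulr_ge0 ?m0 ?e0.
  rewrite (integral_RintegralE ie) integralZr//.
  by rewrite (integral_RintegralE im) -EFinM ltry.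
apply: Fubini; apply: (le_integrable measurableT _ _ ime).
- exact: patch_measurable.
- move=> [x y] _; rewrite !patchE; case: ifPn => //.
  rewrite in_setX/= !in_half_line => /andP[x0 y0].
  by rewrite lee_fin (le_trans (hme _ _ x0 y0))// ler_norm.
Qed.

End iterated.

(** * The kernel ln p / (p^2 - 1) *)

Section log_kernel.
Context {R : realType}.
Local Notation mu := (@lebesgue_measure R).
Local Notation D := (`]0%R, +oo[%classic : set R).
Implicit Types f F g : R -> R.

(** The slope of the chord of [ln] between 1 and [x], extended by continuity
at [x = 1]. *)
Definition ln_slope (x : R) : R := if x == 1 then 1 else ln x / (x - 1).

Lemma ln_slopeM (x : R) : (x - 1) * ln_slope x = ln x.
Proof.
rewrite /ln_slope; case: eqVneq => [->|x1]; first by rewrite subrr mul0r ln1.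
by rewrite mulrC divfK// subr_eq0.
Qed.

Lemma ln_slope_gt0 (x : R) : 0 < x -> 0 < ln_slope x.
Proof.
move=> x0; rewrite /ln_slope; case: eqVneq => // x1.
have [xlt1|xgt1|] := ltgtP x 1; last by move=> /eqP; rewrite (negbTE x1).
  by rewrite nmulr_rgt0 ?invr_lt0 ?subr_lt0// ln_lt0// x0.
by rewrite divr_gt0 ?subr_gt0// ln_gt0.
Qed.

Lemma ln_slope_ge0 (x : R) : 0 < x -> 0 <= ln_slope x.
Proof. by move/ln_slope_gt0/ltW. Qed.

Lemma measurable_ln_slope : measurable_fun [set: R] ln_slope.
Proof.
apply: measurable_fun_ifT; first exact: measurable_fun_eqr.
  exact: measurable_cst.
by prove_measurable; exact: measurable_ln.
Qed.

Lemma ln_slope_sqr (x : R) : 0 < x -> ln_slope (x ^+ 2) = 2 * ln_slope x / (x + 1).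
Proof.
move=> x0; have x1 : x + 1 != 0 by rewrite gt_eqF// addr_gt0.
rewrite /ln_slope sqrf_eq1 [x == -1](_ : _ = false) ?orbF; last first.
  by apply/negbTE; rewrite -addr_eq0.
case: eqVneq => [->|xn1]; first by field.
have x21 : x ^+ 2 - 1 != 0 by rewrite subr_sqr_1 mulf_neq0// subr_eq0.
by rewrite lnXn//; field; rewrite x21 x1 subr_eq0 xn1.
Qed.

Lemma ln_slope_inv (x : R) : 0 < x -> ln_slope x^-1 = x * ln_slope x.
Proof.
move=> x0; have x1 := lt0r_neq0 x0.
rewrite /ln_slope invr_eq1; case: eqVneq => [->|xn1]; first by rewrite mulr1.
rewrite lnV ?posrE//; field.
by rewrite x1 mulN1r !subr_eq0 [1 == x]eq_sym xn1.
Qed.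

Lemma integral_sqr_kernel (b : R) : 0 < b ->
  (\int[mu]_(x in D) (x / ((x ^+ 2 + b) * (x ^+ 2 + 1)))%:E = (ln_slope b / 2)%:E)%E.
Proof.
move=> b0; rewrite /ln_slope; case: eqVneq => [->|b1];
  first by rewrite integral_sqr_kernel1 mul1r.
by rewrite integral_sqr_kernel_neq1//; congr EFin; field; rewrite subr_eq0.
Qed.

Lemma integral_lin_kernel (t : R) : 0 < t ->
  (\int[mu]_(s in D) (((s + t) * (s + 1))^-1)%:E = (ln_slope t)%:E)%E.
Proof.
move=> t0; rewrite /ln_slope; case: eqVneq => [->|t1];
  first by rewrite integral_lin_kernel1.
by rewrite integral_lin_kernel_neq1.
Qed.

(** The function ln p / (p^2 - 1) with its removable singularity at 1 filled
in; see [JM]. *)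
Definition J (p : R) : R := ln_slope p / (p + 1).

Lemma JM (p : R) : 0 < p -> (p ^+ 2 - 1) * J p = ln p.
Proof.
move=> p0; rewrite -ln_slopeM /J; field.
by rewrite gt_eqF// addr_gt0.
Qed.

Lemma J_ge0 (p : R) : 0 < p -> 0 <= J p.
Proof. by move=> p0; rewrite divr_ge0 ?ln_slope_ge0// addr_ge0// ltW. Qed.

Lemma measurable_J : measurable_fun [set: R] J.
Proof. by apply: measurable_fun_div;
  [exact: measurable_ln_slope|prove_measurable]. Qed.

Lemma integral_J_kernel (p : R) : 0 < p ->
  (\int[mu]_(x in D) (x / ((x ^+ 2 + p ^+ 2) * (x ^+ 2 + 1)))%:E = (J p)%:E)%E.
Proof.
move=> p0; rewrite integral_sqr_kernel ?exprn_gt0// ln_slope_sqr//.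
by congr EFin; rewrite /J; field; rewrite gt_eqF// addr_gt0.
Qed.

Lemma ge0_integralZ f (k l : R) :
  measurable_fun D f -> (forall x : R, 0 < x -> 0 <= f x) ->
  0 <= k -> (\int[mu]_(x in D) (f x)%:E = l%:E)%E ->
  (\int[mu]_(x in D) (k * f x)%:E = (k * l)%:E)%E.
Proof.
move=> mf f0 k0 fl; under eq_integral do rewrite EFinM.
rewrite ge0_integralZl// ?fl ?lee_fin//; first exact/measurable_EFinP.
by move=> x; rewrite /= in_itv/= andbT => x0; rewrite lee_fin f0.
Qed.

Lemma measurable_setT_D f : measurable_fun [set: R] f -> measurable_fun D f.
Proof. exact: measurable_funTS. Qed.

Lemma eq_half_line f g : (forall x : R, 0 < x -> f x = g x) ->
  (\int[mu]_(x in D) (f x)%:E = \int[mu]_(x in D) (g x)%:E)%E.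
Proof. by move=> fg; apply: eq_integral => x; rewrite in_half_line => x0;
  rewrite fg. Qed.

(** By Tonelli, since the integral over p of x / ((x^2 + p^2) (x^2 + 1)) is
(pi / 2) / (x^2 + 1). *)
Lemma integral_J : (\int[mu]_(p in D) (J p)%:E = (pi ^+ 2 / 4)%:E)%E.
Proof.
pose h p x : R := x / ((x ^+ 2 + p ^+ 2) * (x ^+ 2 + 1)).
rewrite (@tonelli_half_line_eq _ h _ _ J (fun x => pi / 2 * (x ^+ 2 + 1 ^+ 2)^-1)).
- rewrite (@ge0_integralZ _ _ (pi / (2 * 1))).
  + by congr EFin; field.
  + by apply: measurable_setT_D; prove_measurable.
  + by move=> x x0; rewrite invr_ge0 addr_ge0// sqr_ge0.
  + by rewrite divr_ge0// pi_ge0.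
  + exact: integral_inv_sqrD.
- by rewrite /h; prove_measurable.
- by move=> p x p0 x0; rewrite divr_ge0 ?mulr_ge0 ?addr_ge0 ?sqr_ge0// ltW.
- exact: integral_J_kernel.
- move=> x x0; have x1 := lt0r_neq0 x0.
  have xx : x ^+ 2 + 1 != 0 by rewrite gt_eqF// ltr_wpDl ?sqr_ge0.
  rewrite (@eq_half_line _ (fun p => x / (x ^+ 2 + 1) * (p ^+ 2 + x ^+ 2)^-1));
    last first.
    by move=> p p0; rewrite /h [p ^+ 2 + _]addrC invfM -mulrA [X in _ = _ * X]mulrC.
  rewrite (@ge0_integralZ _ _ (pi / (2 * x))).
  + by congr EFin; field; rewrite xx x1.
  + by apply: measurable_setT_D; prove_measurable.
  + by move=> p p0; rewrite invr_ge0 addr_ge0// sqr_ge0.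
  + by rewrite divr_ge0 ?addr_ge0 ?sqr_ge0// ltW.
  + exact: integral_inv_sqrD.
Qed.

Lemma integrable_J : mu.-integrable D (EFin \o J).
Proof.
apply: ge0_integrable; [exact: measurable_setT_D measurable_J|exact: J_ge0|].
by rewrite integral_J ltry.
Qed.
End log_kernel.

(** * The second logarithmic moment of 1 / (x^2 + 1) *)

Section log_moment.
Context {R : realType}.
Local Notation mu := (@lebesgue_measure R).
Local Notation D := (`]0%R, +oo[%classic : set R).
Implicit Types f F g : R -> R.

(** A Stieltjes transform of [J] in squared variables; in the coordinate
u = ln y it is the third convolution power of 1 / cosh u, up to a factor. *)
Definition stieltjesJ (y : R) : R := \int[mu]_(p in D) (p * J p / (p ^+ 2 + y ^+ 2)).

Lemma ratio_sqrD_le (p y : R) : 0 < p -> 0 < y -> p / (p ^+ 2 + y ^+ 2) <= (2 * y)^-1.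
Proof.
move=> p0 y0; rewrite ler_pdivrMr ?addr_gt0 ?exprn_gt0//
  mulrC ler_pdivlMr ?mulr_gt0//.
by rewrite -subr_ge0 (_ : _ - _ = (p - y) ^+ 2) ?sqr_ge0//; ring.
Qed.

Lemma xJ_ge0 (x : R) : 0 < x -> 0 <= x * J x.
Proof. by move=> x0; rewrite mulr_ge0// ?J_ge0// ltW. Qed.

Lemma integrableZ f (k : R) : mu.-integrable D (EFin \o f) ->
  mu.-integrable D (EFin \o (fun x => k * f x)).
Proof.
move=> fi; have : mu.-integrable D (fun x =>
  k%:E * (EFin \o f) x)%E by exact: integrableZl.
exact: eq_integrable.
Qed.

Lemma integrable_stieltjesJ (y : R) : 0 < y ->
  mu.-integrable D (EFin \o (fun p => p * J p / (p ^+ 2 + y ^+ 2))).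
Proof.
move=> y0; apply: (dominated_integrable _ _ (integrableZ (2 * y)^-1 integrable_J)).
  by apply: measurable_setT_D; prove_measurable; exact: measurable_J.
move=> p p0; rewrite mulrAC ger0_norm; last first.
  by rewrite mulr_ge0 ?[0 <= J _]J_ge0// divr_ge0 ?addr_ge0 ?sqr_ge0// ltW.
by rewrite ler_wpM2r ?J_ge0// ratio_sqrD_le.
Qed.

(** By [JM], ln x = (x^2 - 1) J(x), and |x^2 - 1| <= x^2 + 1: the factor
x^2 + 1 of the denominator is enough to replace ln x by J(x). *)
Lemma integrable_xln (y : R) : 0 < y ->
  mu.-integrable D (EFin \o (fun x => x * ln x / ((x ^+ 2 + y ^+ 2) * (x ^+ 2 + 1)))).
Proof.
move=> y0; apply: (dominated_integrable _ _ (integrable_stieltjesJ y0)).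
  by apply: measurable_setT_D; prove_measurable; exact: measurable_ln.
move=> x x0.
have xy : 0 < x ^+ 2 + y ^+ 2 by rewrite addr_gt0 ?exprn_gt0.
have x1 : 0 < x ^+ 2 + 1 by rewrite addr_gt0 ?exprn_gt0.
have f0 : 0 <= x * J x / (x ^+ 2 + y ^+ 2) by rewrite divr_ge0 ?xJ_ge0// ltW.
rewrite (_ : _ / _ =
  (x * J x / (x ^+ 2 + y ^+ 2)) * ((x ^+ 2 - 1) / (x ^+ 2 + 1))); last first.
  by rewrite -JM//; field; rewrite !lt0r_neq0.
rewrite normrM ger0_norm// ler_piMr//.
rewrite normrM normfV (gtr0_norm x1) ler_pdivrMr// mul1r.
by rewrite (le_trans (ler_normB _ _))// normr1 ger0_norm// sqr_ge0.
Qed.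

Lemma integral_J_kernelR (p : R) : 0 < p ->
  \int[mu]_(x in D) (x / ((x ^+ 2 + p ^+ 2) * (x ^+ 2 + 1))) = J p.
Proof. by move=> p0; rewrite /Rintegral integral_J_kernel. Qed.

Lemma integrable_J_kernel (p : R) : 0 < p ->
  mu.-integrable D (EFin \o (fun x => x / ((x ^+ 2 + p ^+ 2) * (x ^+ 2 + 1)))).
Proof.
move=> p0; apply: ge0_integrable; first by apply: measurable_setT_D; prove_measurable.
  by move=> x x0; rewrite divr_ge0 ?mulr_ge0 ?addr_ge0 ?sqr_ge0// ltW.
by rewrite integral_J_kernel// ltry.
Qed.

Lemma eq_half_lineR f g : (forall x : R, 0 < x -> f x = g x) ->
  \int[mu]_(x in D) f x = \int[mu]_(x in D) g x.
Proof. by move=> fg; rewrite /Rintegral (eq_half_line fg). Qed.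

Lemma substitution_invR (a : R) f : 0 < a ->
  (forall x : R, 0 < x -> {for x, continuous f}) ->
  \int[mu]_(x in D) (f x) = \int[mu]_(x in D) (f (a / x) * (a / x ^+ 2)).
Proof. by move=> a0 cf; rewrite /Rintegral (substitution_inv a0 cf). Qed.

(** The inversion x -> y / x maps this integral I to ln y J(y) - I. *)
Lemma integral_xln (y : R) : 0 < y ->
  \int[mu]_(x in D) (x * ln x / ((x ^+ 2 + y ^+ 2) * (x ^+ 2 + 1))) = ln y / 2 * J y.
Proof.
move=> y0; have half_eq (a b : R) : a = b - a -> a = b / 2 by move=> ?; lra.
pose f (x : R) : R := x * ln x / ((x ^+ 2 + y ^+ 2) * (x ^+ 2 + 1)).
have cf (x : R) : 0 < x -> {for x, continuous f}.
  move=> x0; rewrite /f; apply: has_derivative_continuous; derive_rules => //.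
  by apply: lt0r_neq0; rewrite /= mulr_gt0// addr_gt0// exprn_gt0.
suff E : \int[mu]_(x in D) f x = ln y * J y - \int[mu]_(x in D) f x.
  by rewrite mulrAC; exact: half_eq E.
rewrite {1}(substitution_invR y0 cf) -(integral_J_kernelR y0) -RintegralZl//;
  last first.
  exact: integrable_J_kernel.
rewrite -RintegralB//; last 2 first.
  exact/integrableZ/integrable_J_kernel.
  exact: integrable_xln.
apply: eq_half_lineR => x x0; rewrite /f ln_div ?posrE//; field.
by rewrite !lt0r_neq0 ?addr_gt0 ?exprn_gt0 ?mulr_gt0.
Qed.

(** With q(y) = (y^2 + 1) / (p^2 + y^2) one has
q(y) - q(1) = (p^2 - 1) (y^2 - 1) / ((p^2 + y^2) (p^2 + 1)).  Here p^2 - 1 turns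
J(p) into ln p, so [integral_xln] applies, and y^2 - 1 turns the resulting
J(y) into ln y. *)
Lemma stieltjesJE (y : R) : 0 < y -> stieltjesJ y =
  (ln y ^+ 2 / 2 + 2 * stieltjesJ 1) / (y ^+ 2 + 1).
Proof.
move=> y0; have y1 : 0 < y ^+ 2 + 1 by rewrite addr_gt0 ?exprn_gt0.
apply: (mulIf (lt0r_neq0 y1)); rewrite divfK ?lt0r_neq0//.
apply/eqP; rewrite -subr_eq mulrC; apply/eqP.
have -> : ln y ^+ 2 / 2 = (y ^+ 2 - 1) * (ln y / 2 * J y)
  by rewrite mulrCA JM//; field.
rewrite /stieltjesJ -integral_xln// -!RintegralZl//;
  try exact: integrable_stieltjesJ; last exact: integrable_xln.
rewrite -RintegralB//; try by apply: integrableZ; exact: integrable_stieltjesJ.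
apply: eq_half_lineR => p p0; rewrite -JM//; field.
by rewrite ?expr1n !lt0r_neq0 ?addr_gt0 ?exprn_gt0.
Qed.

(** In the symmetric integral of 1 / ((s + t) (s + 1) (t + 1)) over the
quadrant put s = x^-2, which gives the kernel [h] below.  Integrating [h] over x
gives J(t), and integrating it over t gives 4 x J(x) / (x^2 + 1), which is the
integrand of 4 P(1). *)
Lemma stieltjesJ1 : stieltjesJ 1 = pi ^+ 2 / 16.
Proof.
pose h (t x : R) : R := 2 * x / ((1 + t * x ^+ 2) * (1 + x ^+ 2) * (t + 1)).
suff : (\int[mu]_(t in D) (J t)%:E =
        \int[mu]_(x in D) (4 * (x * J x / (x ^+ 2 + 1 ^+ 2)))%:E)%E.
  rewrite integral_J integral_RintegralE;
    last exact/integrableZ/integrable_stieltjesJ.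
  rewrite RintegralZl//; last exact: integrable_stieltjesJ.
  by move=> [] E; rewrite /stieltjesJ; lra.
apply: (@tonelli_half_line_eq _ h).
- by rewrite /h; prove_measurable.
- move=> t x t0 x0; rewrite /h divr_ge0 ?mulr_ge0 ?addr_ge0 ?mulr_ge0 ?sqr_ge0//; exact: ltW.
- move=> t t0; have t1 := lt0r_neq0 t0.
  have tt : t + 1 != 0 by rewrite gt_eqF// addr_gt0.
  rewrite (@eq_half_line _ _
    (fun x => 2 / (t * (t + 1)) * (x / ((x ^+ 2 + t^-1) * (x ^+ 2 + 1))))).
    rewrite (@ge0_integralZ _ _ _ (ln_slope t^-1 / 2)).
    + by rewrite ln_slope_inv// /J; congr EFin; field; rewrite t1 tt.
    + by apply: measurable_setT_D; prove_measurable.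
    + by move=> x x0; rewrite divr_ge0 ?mulr_ge0 ?addr_ge0 ?sqr_ge0 ?invr_ge0// ltW.
    + by rewrite divr_ge0 ?mulr_ge0 ?addr_ge0// ltW.
    + by rewrite integral_sqr_kernel// invr_gt0.
  move=> x x0; rewrite /h; field.
  by rewrite t1 tt !lt0r_neq0 ?addr_gt0 ?mulr_gt0 ?exprn_gt0 ?invr_gt0.
- move=> x x0; have x1 := lt0r_neq0 x0.
  have xx : x + 1 != 0 by rewrite gt_eqF// addr_gt0.
  have x2 : x ^+ 2 + 1 != 0 by rewrite gt_eqF// addr_gt0 ?exprn_gt0.
  rewrite (@eq_half_line _ _
    (fun t => 2 / (x * (x ^+ 2 + 1)) * ((t + (x ^+ 2)^-1) * (t + 1))^-1)).
    rewrite (@ge0_integralZ _ _ _ (ln_slope (x ^+ 2)^-1)).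
    + rewrite ln_slope_inv ?exprn_gt0// ln_slope_sqr// /J; congr EFin; field.
      by rewrite ?expr1n x1 xx x2.
    + by apply: measurable_setT_D; prove_measurable.
    + by move=> t t0; rewrite invr_ge0 ?mulr_ge0 ?addr_ge0 ?invr_ge0 ?sqr_ge0// ltW.
    + by rewrite divr_ge0 ?mulr_ge0 ?addr_ge0 ?sqr_ge0// ltW.
    + by rewrite integral_lin_kernel// invr_gt0 exprn_gt0.
  move=> t t0; rewrite /h; field.
  by rewrite x1 x2 !lt0r_neq0 ?addr_gt0 ?mulr_gt0 ?exprn_gt0 ?invr_gt0.
Qed.

(** By Tonelli, since the integral over y of p / (p^2 + y^2) is pi / 2. *)
Lemma integral_stieltjesJ : (\int[mu]_(y in D) (stieltjesJ y)%:E =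
  (pi ^+ 3 / 8)%:E)%E.
Proof.
rewrite -(@tonelli_half_line_eq _ (fun p y =>
  p * J p / (p ^+ 2 + y ^+ 2)) _ _ (fun p => pi / 2 * J p)).
- rewrite (@ge0_integralZ _ _ _ (pi ^+ 2 / 4)).
  + by congr EFin; field.
  + exact: measurable_setT_D measurable_J.
  + exact: J_ge0.
  + by rewrite divr_ge0// pi_ge0.
  + exact: integral_J.
- by prove_measurable; apply: measurableT_comp; [exact: measurable_J|].
- by move=> p y p0 y0; rewrite divr_ge0 ?xJ_ge0// addr_ge0// sqr_ge0.
- move=> p p0; have p1 := lt0r_neq0 p0.
  rewrite (@eq_half_line _ _ (fun y => p * J p * (y ^+ 2 + p ^+ 2)^-1)); last first.
    by move=> y y0; rewrite addrC.
  rewrite (@ge0_integralZ _ _ _ (pi / (2 * p))).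
  + by congr EFin; field.
  + by apply: measurable_setT_D; prove_measurable.
  + by move=> y y0; rewrite invr_ge0 addr_ge0// sqr_ge0.
  + exact: xJ_ge0.
  + exact: integral_inv_sqrD.
- by move=> y y0; rewrite integral_RintegralE//; exact: integrable_stieltjesJ.
Qed.

(** Integrate the closed form of [stieltjesJ] and compare with
[integral_stieltjesJ]. *)
Lemma integral_ln2 :
  (\int[mu]_(y in D) (ln y ^+ 2 / (y ^+ 2 + 1))%:E = (pi ^+ 3 / 8)%:E)%E.
Proof.
have := integral_stieltjesJ.
rewrite (@eq_half_line _ _
  (fun y => 2^-1 * (ln y ^+ 2 / (y ^+ 2 + 1)) + pi ^+ 2 / 8 * (y ^+ 2 + 1 ^+ 2)^-1)); last first.
  move=> y y0; rewrite stieltjesJE// stieltjesJ1 expr1n; field.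
  by rewrite gt_eqF// addr_gt0 ?exprn_gt0.
under eq_integral do rewrite EFinD.
rewrite ge0_integralD//; first last.
- by apply/measurable_EFinP; apply: measurable_setT_D; prove_measurable.
- by move=> x _; rewrite lee_fin mulr_ge0 ?invr_ge0 ?addr_ge0 ?sqr_ge0//
  divr_ge0 ?sqr_ge0.
- by apply/measurable_EFinP; apply: measurable_setT_D; prove_measurable;
  exact: measurable_ln.
- by move=> x _; rewrite lee_fin mulr_ge0 ?divr_ge0 ?addr_ge0 ?sqr_ge0.
rewrite [X in (_ + X)%E = _](@ge0_integralZ _ _ _ (pi / (2 * 1))); first last.
- exact: integral_inv_sqrD.
- by rewrite divr_ge0// sqr_ge0.
- by move=> x x0; rewrite invr_ge0 addr_ge0// sqr_ge0.
- by apply: measurable_setT_D; prove_measurable.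
under eq_integral do rewrite EFinM.
rewrite ge0_integralZl//; last 2 first.
- by apply/measurable_EFinP; apply: measurable_setT_D; prove_measurable;
  exact: measurable_ln.
- by move=> x _; rewrite lee_fin ?divr_ge0 ?addr_ge0 ?sqr_ge0.
case: (\int[mu]_(x in D) _)%E => [c| |].
- by rewrite -EFinM -EFinD => -[] E; congr EFin; lra.
- by rewrite gt0_muley ?lte_fin// addye.
- by rewrite gt0_muleNy ?lte_fin// addNye.
Qed.

End log_moment.

(** * Laplace side: logarithmic integrals against p / (x^2 + p^2) *)

Section log_integrals.
Context {R : realType}.
Local Notation mu := (@lebesgue_measure R).
Local Notation D := (`]0%R, +oo[%classic : set R).
Implicit Types f F g w : R -> R.

Lemma sqrD_gt0 (x p : R) : 0 < p -> 0 < x ^+ 2 + p ^+ 2.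
Proof. by move=> p0; rewrite ltr_wpDl ?sqr_ge0// exprn_gt0. Qed.

Lemma sqrD1_gt0 (x : R) : 0 < x ^+ 2 + 1.
Proof. by rewrite ltr_wpDl ?sqr_ge0. Qed.

Lemma integrableD_half_line f g :
  mu.-integrable D (EFin \o f) -> mu.-integrable D (EFin \o g) ->
  mu.-integrable D (EFin \o (fun x => f x + g x)).
Proof.
move=> fi gi; have : mu.-integrable D ((EFin \o f) \+ (EFin \o g))%E
  by exact: integrableD.
exact: eq_integrable.
Qed.

Lemma integrable_inv_sqrD (p : R) : 0 < p ->
  mu.-integrable D (EFin \o (fun x => (x ^+ 2 + p ^+ 2)^-1)).
Proof.
move=> p0; apply: ge0_integrable; first by apply: measurable_setT_D; prove_measurable.
  by move=> x x0; rewrite invr_ge0 ltW// sqrD_gt0.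
by rewrite integral_inv_sqrD// ltry.
Qed.

Lemma integrable_inv_sqrD1 : mu.-integrable D (EFin \o (fun x => (x ^+ 2 + 1)^-1)).
Proof.
have := integrable_inv_sqrD ltr01.
by apply: eq_integrable => // x _; rewrite /= expr1n.
Qed.

Lemma measurable_ln_ratio (k : nat) :
  measurable_fun [set: R] (fun x => ln x ^+ k / (x ^+ 2 + 1)).
Proof. by prove_measurable; exact: measurable_ln. Qed.

Lemma integrable_ln2 : mu.-integrable D (EFin \o (fun x => ln x ^+ 2 / (x ^+ 2 + 1))).
Proof.
apply: ge0_integrable; first exact: measurable_setT_D (measurable_ln_ratio 2).
  by move=> x x0; rewrite divr_ge0 ?sqr_ge0// ltW// sqrD1_gt0.
by rewrite integral_ln2 ltry.
Qed.

(** For k = 0, 1, 2 one has |ln x|^k <= 1 + ln^2 x. *)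
Lemma integrable_ln_ratio (k : nat) : (k <= 2)%N ->
  mu.-integrable D (EFin \o (fun x => ln x ^+ k / (x ^+ 2 + 1))).
Proof.
move=> k2; have := integrableD_half_line integrable_inv_sqrD1 integrable_ln2.
apply: dominated_integrable; first exact: measurable_setT_D (measurable_ln_ratio k).
move=> x x0; rewrite -{2}[(_ + 1)^-1]mul1r -mulrDl normrM normfV.
rewrite (gtr0_norm (sqrD1_gt0 x)) ler_wpM2r ?invr_ge0 ?(ltW (sqrD1_gt0 x))//.
case: k k2 => [|[|[|//]]] _; rewrite ?expr0 ?expr1.
- by rewrite normr1 lerDl sqr_ge0.
- rewrite -[ln x ^+ 2]real_normK ?num_real//; set a := `|_|.
  have := sqr_ge0 (a - 1); have : 0 <= a by exact: normr_ge0.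
  by nra.
- by rewrite ger0_norm ?sqr_ge0// lerDr.
Qed.

(** The denominators are comparable: x^2 + 1 <= (1 + p^-2) (x^2 + p^2). *)
Lemma integrable_ln_sqrD (k : nat) (p : R) : (k <= 2)%N -> 0 < p ->
  mu.-integrable D (EFin \o (fun x => ln x ^+ k / (x ^+ 2 + p ^+ 2))).
Proof.
move=> k2 p0; have p1 := lt0r_neq0 p0.
have := integrable_abse (integrable_ln_ratio k2).
move=> /(@integrableZ _ (fun x => `|ln x ^+ k / (x ^+ 2 + 1)|) (1 + p ^- 2)).
apply: dominated_integrable; first by apply: measurable_setT_D; prove_measurable;
  exact: measurable_ln.
move=> x x0; rewrite !normrM mulrCA ler_wpM2l// !normfV.
rewrite !gtr0_norm ?sqrD_gt0 ?sqrD1_gt0// -[leLHS]mul1r ler_pdivrMr ?sqrD_gt0//.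
rewrite mulrAC ler_pdivlMr ?sqrD1_gt0//
  mul1r mulrDl mul1r mulrDr [_ * p ^+ 2]mulVf ?expf_neq0//.
have : 0 <= p ^- 2 * x ^+ 2 by rewrite mulr_ge0 ?invr_ge0 ?sqr_ge0.
by have := sqr_ge0 p; lra.
Qed.

Definition int_ln (p : R) : R := \int[mu]_(x in D) (ln x / (x ^+ 2 + p ^+ 2)).
Definition int_ln2 (p : R) : R := \int[mu]_(x in D) (ln x ^+ 2 / (x ^+ 2 + p ^+ 2)).

Lemma integrable_ln1 (p : R) : 0 < p ->
  mu.-integrable D (EFin \o (fun x => ln x / (x ^+ 2 + p ^+ 2))).
Proof. exact: (@integrable_ln_sqrD 1). Qed.

Lemma integral_inv_sqrDR (a : R) : 0 < a ->
  \int[mu]_(x in D) (x ^+ 2 + a ^+ 2)^-1 = pi / (2 * a).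
Proof. by move=> a0; rewrite /Rintegral integral_inv_sqrD. Qed.

(** The inversion x -> p / x changes dx / (x^2 + p^2) into
(1 / p) dx / (x^2 + 1) and ln x into ln p - ln x.  At p = 1 the formula reads
I = - I, which determines the remaining constant. *)
Lemma int_ln_rec (p : R) : 0 < p -> int_ln p = (ln p * (pi / 2) - int_ln 1) / p.
Proof.
move=> p0; rewrite mulrC /int_ln (@substitution_invR _ p)//; last first.
  move=> x x0; apply: has_derivative_continuous; derive_rules => //.
  exact/lt0r_neq0/sqrD_gt0.
have -> : pi / 2 = \int[mu]_(x in D) (x ^+ 2 + 1 ^+ 2)^-1 :> R.
  by rewrite integral_inv_sqrDR// mulr1.
rewrite -!RintegralZl//; last exact: integrable_inv_sqrD.
rewrite -RintegralB//; [|exact/integrableZ/integrable_inv_sqrD|exact: integrable_ln1].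
rewrite -RintegralZl//; last first.
  have := integrableD_half_line (integrableZ (ln p) (integrable_inv_sqrD ltr01))
    (integrableZ (-1) (integrable_ln1 ltr01)).
  by apply: eq_integrable => // x _ /=; rewrite mulN1r.
apply: eq_half_lineR => x x0; rewrite ln_div ?posrE//; field.
by rewrite ?expr1n !lt0r_neq0 ?sqrD1_gt0// addr_gt0 ?exprn_gt0 ?mulr_gt0.
Qed.

Lemma int_ln1 : int_ln 1 = 0.
Proof. by have := int_ln_rec ltr01; rewrite ln1 mul0r sub0r divr1; lra. Qed.

Lemma int_lnE (p : R) : 0 < p -> int_ln p = pi * ln p / (2 * p).
Proof. by move=> p0; rewrite int_ln_rec// int_ln1; field; rewrite lt0r_neq0. Qed.

Lemma int_ln2_1 : int_ln2 1 = pi ^+ 3 / 8.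
Proof.
transitivity (\int[mu]_(x in D) (ln x ^+ 2 / (x ^+ 2 + 1)) : R).
  by rewrite /int_ln2; apply: eq_half_lineR => x _; rewrite expr1n.
by rewrite /Rintegral integral_ln2.
Qed.

Lemma int_ln2E (p : R) : 0 < p -> int_ln2 p = (pi ^+ 3 / 8 + pi * ln p ^+ 2 / 2) / p.
Proof.
move=> p0; rewrite mulrC {1}/int_ln2 (@substitution_invR _ p)//; last first.
  move=> x x0; apply: has_derivative_continuous; derive_rules => //.
  exact/lt0r_neq0/sqrD_gt0.
have -> : pi ^+ 3 / 8 + pi * ln p ^+ 2 / 2 =
    int_ln2 1 + (ln p ^+ 2 * (\int[mu]_(x in D)
      (x ^+ 2 + 1 ^+ 2)^-1) + (- 2 * ln p) * int_ln 1) :> R.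
  by rewrite integral_inv_sqrDR// int_ln1 int_ln2_1; field.
have i0 := integrable_inv_sqrD ltr01.
have i1 := integrable_ln1 ltr01.
have i2 := @integrable_ln_sqrD 2 _ isT ltr01.
rewrite /int_ln2 /int_ln -!RintegralZl//.
rewrite -RintegralD//; [|exact: integrableZ|exact: integrableZ].
rewrite -RintegralD//; last by apply: integrableD_half_line; exact: integrableZ.
rewrite -RintegralZl//; last first.
  by apply: integrableD_half_line => //; apply: integrableD_half_line;
    exact: integrableZ.
apply: eq_half_lineR => x x0; rewrite ln_div ?posrE//; field.
by rewrite ?expr1n !lt0r_neq0 ?sqrD1_gt0// addr_gt0 ?exprn_gt0 ?mulr_gt0.
Qed.

(** (p^2 - 1) / ((x^2 + 1) (x^2 + p^2)) = 1 / (x^2 + 1) - 1 / (x^2 + p^2). *)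
Lemma integral_partial_fractions (k : nat) (p : R) : (k <= 2)%N -> 0 < p ->
  (p ^+ 2 - 1) * \int[mu]_(x in D)
    (ln x ^+ k / (x ^+ 2 + 1) * (p / (x ^+ 2 + p ^+ 2))) =
  p * (\int[mu]_(x in D) (ln x ^+ k / (x ^+ 2 + 1 ^+ 2)) -
       \int[mu]_(x in D) (ln x ^+ k / (x ^+ 2 + p ^+ 2))).
Proof.
move=> k2 p0; have i1 := integrable_ln_sqrD k2 ltr01;
  have ip := integrable_ln_sqrD k2 p0.
have E (x : R) : 0 < x ->
  (p ^+ 2 - 1) * (ln x ^+ k / (x ^+ 2 + 1) * (p / (x ^+ 2 + p ^+ 2))) =
    p * (ln x ^+ k / (x ^+ 2 + 1 ^+ 2) - ln x ^+ k / (x ^+ 2 + p ^+ 2)).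
  move=> x0; field.
  by rewrite ?expr1n !lt0r_neq0 ?sqrD1_gt0 ?sqrD_gt0.
rewrite -RintegralB// -RintegralZl//; last first.
  apply: (dominated_integrable _ _ (integrableZ p^-1 (integrable_abse
    (integrable_ln_ratio k2)))).
    by apply: measurable_setT_D; prove_measurable; exact: measurable_ln.
  move=> x x0; rewrite normrM mulrC ler_wpM2r// ger0_norm; last first.
    by rewrite divr_ge0 ?(ltW (sqrD_gt0 _ _))// ltW.
  rewrite ler_pdivrMr ?sqrD_gt0// mulrDr [p ^+ 2]expr2 mulKf ?lt0r_neq0//.
  by rewrite lerDr mulr_ge0 ?sqr_ge0// invr_ge0 ltW.
rewrite -RintegralZl//; first exact: eq_half_lineR.
have := integrableD_half_line i1 (integrableZ (-1) ip).
by apply: eq_integrable => // x _ /=; rewrite mulN1r.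
Qed.

Lemma integral_cos_ln (p : R) : 0 < p -> p != 1 ->
  \int[mu]_(x in D) (ln x ^+ 1 / (x ^+ 2 + 1) * (p / (x ^+ 2 + p ^+ 2))) =
    - (pi / 2 * J p).
Proof.
move=> p0 p1; have pp : p ^+ 2 - 1 != 0.
  by rewrite subr_sqr_1 mulf_neq0 ?subr_eq0// lt0r_neq0// addr_gt0.
apply: (mulfI pp); rewrite integral_partial_fractions//.
have := int_ln1; have := int_lnE p0; rewrite /int_ln => -> ->.
by rewrite mulrN mulrCA JM//; field; rewrite lt0r_neq0.
Qed.

Lemma integral_cos_ln2 (p : R) : 0 < p -> p != 1 ->
  \int[mu]_(x in D) (ln x ^+ 2 / (x ^+ 2 + 1) * (p / (x ^+ 2 + p ^+ 2))) =
  pi ^+ 3 / 8 / (p + 1) - pi / 2 * ln p * J p.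
Proof.
move=> p0 p1; have p1' : p + 1 != 0 by rewrite lt0r_neq0// addr_gt0.
have pp : p ^+ 2 - 1 != 0 by rewrite subr_sqr_1 mulf_neq0 ?subr_eq0.
apply: (mulfI pp); rewrite integral_partial_fractions//.
have := int_ln2_1; have := int_ln2E p0; rewrite /int_ln2 => -> ->.
rewrite [RHS]mulrBr [X in _ = _ - X]mulrCA JM//; field.
by rewrite p1' lt0r_neq0.
Qed.

End log_integrals.

(** * Uniqueness for the Laplace transform *)

Section uniqueness.
Context {R : realType}.
Local Notation mu := (@lebesgue_measure R).
Local Notation D := (`]0%R, +oo[%classic : set R).
Implicit Types f F g w : R -> R.

Lemma integrable_expR (p : R) : 0 < p ->
  mu.-integrable D (EFin \o (fun t => expR (- (p * t)))).
Proof.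
move=> p0; apply: ge0_integrable; first by apply: measurable_setT_D; prove_measurable.
  by move=> t _; exact: expR_ge0.
by rewrite integral_expR// ltry.
Qed.

Lemma integrable_expRM (H : R -> R) (M p : R) : 0 < p -> measurable_fun D H ->
  (forall t : R, 0 < t -> `|H t| <= M) ->
  mu.-integrable D (EFin \o (fun t => expR (- (p * t)) * H t)).
Proof.
move=> p0 mH HM; apply: (dominated_integrable _ _ (integrableZ M
  (integrable_expR p0))).
  by apply: measurable_funM => //; apply: measurable_setT_D; prove_measurable.
by move=> t t0; rewrite normrM ger0_norm ?expR_ge0// mulrC ler_wpM2r ?expR_ge0// HM.
Qed.

Section vanishing.
Variables (H : R -> R) (M : R).
Hypothesis HM : forall t : R, 0 < t -> `|H t| <= M.
Hypothesis cH : forall t : R, 0 < t -> {for t, continuous H}.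
Hypothesis H0 : forall n : nat, (2 <= n)%N ->
  \int[mu]_(t in D) (expR (- (n%:R * t)) * H t) = 0.

Let mH : measurable_fun D H. Proof. exact: measurable_fun_half_line. Qed.

(** A power of e^-t only shifts the exponent, so that by linearity [H] is also
orthogonal to e^-nt q(e^-t) for every polynomial q. *)
Lemma polynomial_moments (q : {poly R}) (n : nat) : (2 <= n)%N ->
  let f := fun t => q.[expR (- t)] * (expR (- (n%:R * t)) * H t) in
  mu.-integrable D (EFin \o f) /\ \int[mu]_(t in D) f t = 0.
Proof.
elim/poly_ind: q n => [|q c IH] n n2 /=.
  have E : (fun t => (0 : {poly R}).[expR (- t)] * (expR (- (n%:R * t)) * H t)) =
    cst 0.
    by apply/funext => t; rewrite horner0 mul0r.
  rewrite E; split; first exact: integrable0.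
  by rewrite /Rintegral integral0.
have [i1 e1] := IH n.+1 (leqW n2).
have i2 : mu.-integrable D (EFin \o (fun t => c * (expR (- (n%:R * t)) * H t))).
  by apply: integrableZ; apply: integrable_expRM HM => //; rewrite ltr0n ltnW.
have E : (fun t => (q * 'X + c%:P).[expR (- t)] * (expR (- (n%:R * t)) * H t)) =
    (fun t => q.[expR (- t)] * (expR (- (n.+1%:R * t)) * H t) + c * (expR
      (- (n%:R * t)) * H t)).
  apply/funext => t; rewrite hornerMXaddC mulrDl; congr (_ + _).
  rewrite -mulrA; congr (_ * _); rewrite mulrA -expRD; congr (expR _ * _).
  by rewrite -natr1; ring.
rewrite E; split; first exact: integrableD_half_line.
rewrite RintegralD// e1 add0r RintegralZl// ?H0 ?mulr0//.
by apply: integrable_expRM HM => //; rewrite ltr0n ltnW.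
Qed.

(** Suppose H(t0) > 0 and put c = e^-t0.  The function K(t) = 1 - (e^-t - c)^2
takes values in [0, 1] and peaks at t0.  Its powers are polynomials in e^-t, so
the integral of K^N e^-2t H vanishes.  As N grows, the contribution of a
neighbourhood of t0, which is positive, dominates the rest. *)
Lemma laplace_le0 (t0 : R) : 0 < t0 -> H t0 <= 0.
Proof.
move=> t00; rewrite leNgt; apply/negP => Ht0.
have M0 : 0 <= M by exact: le_trans (HM t00).
have e_lt1 (t : R) : 0 < t -> expR (- t) < 1 by move=> ?; rewrite expR_lt1 oppr_lt0.
pose c := expR (- t0).
have [r [r0 rt0 Hr]] : exists r : R, [/\ 0 < r, r < t0 &
    forall t, `|t0 - t| < r -> H t0 / 2 <= H t].
  have /cvgrPdist_lt/(_ (H t0 / 2)) := cH t00.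
  rewrite divr_gt0// => /(_ isT) /nbhs_ballP[d /= d0 dH].
  exists (Num.min d (t0 / 2)); split.
  - by rewrite lt_min d0 divr_gt0.
  - by rewrite gt_min [_ / 2 < _](_ : _ = true) ?orbT//; lra.
  - move=> t; rewrite lt_min => /andP[td _].
    by have := dH t td; rewrite /= ltr_norml => /andP[_]; lra.
(* Where e^-t is closer to c than eta, t is closer to t0 than r, so H is at
   least H(t0) / 2 there. *)
pose eta := Num.min (c - expR (- (t0 + r))) (expR (- (t0 - r)) - c).
have eta0 : 0 < eta by rewrite lt_min !subr_gt0 !ltr_expR; apply/andP; split; lra.
have eta1 : eta < 1.
  by rewrite gt_min; have := e_lt1 _ t00; have := expR_gt0 (- (t0 + r));
    rewrite -/c => ? ?; apply/orP; left; lra.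
have near_t0 (t : R) : `|expR (- t) - c| < eta -> `|t0 - t| < r.
  rewrite lt_min => /andP[]; rewrite !ltr_norml => /andP[h1 _] /andP[_ h2].
  have : expR (- (t0 + r)) < expR (- t) by lra.
  have : expR (- t) < expR (- (t0 - r)) by lra.
  by rewrite !ltr_expR => ? ?; apply/andP; split; lra.
have [s [s0 sr Hs]] : exists s : R, [/\ 0 < s, s <= r &
    forall t, `|t0 - t| < s -> `|expR (- t) - c| < eta / 2].
  have : {for t0, continuous (fun t : R => expR (- t))}
    by apply: has_derivative_continuous; derive_rules.
  move=> /cvgrPdist_lt/(_ (eta / 2)); rewrite divr_gt0//
    => /(_ isT) /nbhs_ballP[d /= d0 dH].
  exists (Num.min d r); split.
  - by rewrite lt_min d0 r0.
  - by rewrite ge_min lexx orbT.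
  - by move=> t; rewrite lt_min => /andP[td _]; rewrite distrC; exact: dH.
pose K (t : R) := 1 - (expR (- t) - c) ^+ 2.
(* K is at most kap where e^-t is eta-far from c, and at least kap' where it is
   (eta / 2)-close to c, hence for t closer to t0 than s. *)
pose kap := 1 - eta ^+ 2.
pose kap' := 1 - (eta / 2) ^+ 2.
pose a := H t0 / 2 * expR (- (2 * (t0 + r))).
have a0 : 0 < a by rewrite mulr_gt0 ?expR_gt0 ?divr_gt0.
have kap0 : 0 <= kap by rewrite subr_ge0 expr_le1 ?ltW.
have kapkap' : kap < kap'.
  have : 0 < eta ^+ 2 by rewrite exprn_gt0.
  by rewrite /kap /kap'; nra.
have kap'0 : 0 < kap' := le_lt_trans kap0 kapkap'.
have c0 : 0 < c := expR_gt0 _.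
have K0 (t : R) : 0 < t -> 0 <= K t.
  move=> t1; rewrite subr_ge0 -[leLHS]real_normK ?num_real// expr_le1 ?normr_ge0//.
  rewrite ler_norml; have := e_lt1 _ t1; have := e_lt1 _ t00; rewrite -/c.
  by have := expR_gt0 (- t) => *; apply/andP; split; lra.
have key N : kap' ^+ N * (a * (2 * s)) <= kap ^+ N * (M / 2).
  pose q : {poly R} := (1 - ('X - c%:P) ^+ 2) ^+ N.
  pose f (t : R) := q.[expR (- t)] * (expR (- (2%:R * t)) * H t).
  have [fi fe] := @polynomial_moments q 2 isT.
  rewrite -/f in fi fe.
  have fE t : f t = K t ^+ N * (expR (- (2 * t)) * H t).
    by rewrite /f /q !hornerE_comm; congr (_ * _); rewrite !hornerE.
  (* Adding kap^N M e^-2t to f, whose integral is 0, makes it nonnegative: its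
     negative part lives where K <= kap. *)
  pose g t := f t + kap ^+ N * M * expR (- (2 * t)).
  have ei := integrable_expR (ltr0n R 2).
  have gi : mu.-integrable D (EFin \o g) by apply: integrableD_half_line =>
    //; exact: integrableZ.
  have gE : (\int[mu]_(t in D) (g t)%:E = (kap ^+ N * (M / 2))%:E)%E.
    rewrite integral_RintegralE// RintegralD//; last exact: integrableZ.
    rewrite fe add0r RintegralZl// /Rintegral integral_expR//=.
    by congr EFin; field.
  have g0 (t : R) : 0 < t -> 0 <= g t.
    move=> t1; rewrite /g fE.
    have e0 := expR_ge0 (- (2 * t)).
    have b0 : 0 <= kap ^+ N * M * expR (- (2 * t)) by rewrite !mulr_ge0// exprn_ge0.
    have [near|far] := ltP `|expR (- t) - c| eta.
      have /Hr Ht := near_t0 t near.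
      by rewrite addr_ge0// !mulr_ge0 ?exprn_ge0 ?K0// (le_trans _ Ht)// divr_ge0//
        ltW.
    have Kk : K t ^+ N <= kap ^+ N.
      apply: lerXn2r; rewrite ?nnegrE ?K0// /K /kap lerB//.
      rewrite -[leRHS]real_normK ?num_real// lerXn2r ?nnegrE//; exact: ltW.
    have HtM : - M <= H t by have := HM t1; rewrite ler_norml => /andP[].
    have : K t ^+ N * (expR (- (2 * t)) * - M) <= K t ^+ N * (expR (- (2 * t)) * H t).
      by rewrite ler_wpM2l ?exprn_ge0 ?K0// ler_wpM2l.
    have : K t ^+ N * (expR (- (2 * t)) * M) <= kap ^+ N * (expR (- (2 * t)) * M).
      by rewrite ler_wpM2r// mulr_ge0.
    by rewrite !mulrN -!mulrA [M * _]mulrC; lra.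
  have gU (t : R) : `|t0 - t| < s -> kap' ^+ N * a <= g t.
    move=> ts; have tr : `|t0 - t| < r := lt_le_trans ts sr.
    have t1 : 0 < t by move: tr; rewrite ltr_norml => /andP[_]; lra.
    have b0 : 0 <= kap ^+ N * M * expR (- (2 * t)).
      by rewrite !mulr_ge0 ?expR_ge0// exprn_ge0.
    rewrite /g fE ler_wpDr// ler_pM ?exprn_ge0 ?(ltW a0) ?(ltW kap'0)//.
      apply: lerXn2r; rewrite ?nnegrE ?K0 ?(ltW kap'0)// /K /kap' lerB//.
      rewrite -[leLHS]real_normK ?num_real// lerXn2r ?nnegrE ?divr_ge0 ?(ltW eta0)//.
      exact/ltW/Hs.
    rewrite /a mulrC ler_pM ?expR_ge0 ?divr_ge0 ?Hr// ?(ltW Ht0)//.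
    by rewrite ler_expR; move: tr; rewrite ltr_norml => /andP[]; lra.
  pose U : set R := `]t0 - s, t0 + s[%classic.
  have mU : measurable U by exact: measurable_itv.
  have UD : U `<=` D.
    by move=> t; rewrite /U /=; rewrite !in_itv/= andbT => /andP[+ _]; lra.
  have mg : measurable_fun D (EFin \o g) by case/integrableP: gi.
  rewrite -lee_fin -gE.
  apply: (@le_trans _ _ (\int[mu]_(t in U) (g t)%:E)%E); last first.
    apply: ge0_subset_integral => //.
    by move=> t; rewrite /= in_itv/= andbT => t1; rewrite lee_fin g0.
  have -> : ((kap' ^+ N * (a * (2 * s)))%:E =
      \int[mu]_(t in U) (kap' ^+ N * a)%:E)%E.
    rewrite integral_cst// /U /= lebesgue_measure_itv/= lte_fin ifT; last by lra.
    by rewrite -EFinB -EFinM; congr EFin; ring.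
  apply: ge0_le_integral => //.
  - by move=> t _; rewrite lee_fin mulr_ge0 ?exprn_ge0 ?(ltW a0) ?(ltW kap'0).
  - exact: measurable_funS mg.
  - move=> t; rewrite /U /= in_itv/= => /andP[t1 t2]; rewrite lee_fin gU//.
    by rewrite ltr_norml; apply/andP; split; lra.
(* (kap / kap')^N tends to 0, which contradicts key for large N. *)
clearbody a kap kap'.
have : (kap / kap') ^+ n @[n --> \oo] --> (0 : R).
  apply: cvg_expr; rewrite ger0_norm ?divr_ge0// ?ltW// ltr_pdivrMr// mul1r//.
move=> /cvgrPdist_lt/(_ (a * (2 * s) / (M / 2 + 1))).
have M21 : 0 < M / 2 + 1 by rewrite ltr_wpDl// divr_ge0.
rewrite divr_gt0 ?mulr_gt0// => /(_ isT)[N _ /(_ N (leqnn _))] /=.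
rewrite sub0r normrN ger0_norm ?exprn_ge0 ?divr_ge0 ?(ltW kap'0)//.
rewrite ltr_pdivlMr// expr_div_n mulrAC ltr_pdivrMr ?exprn_gt0//.
have := key N; rewrite [X in _ -> X < _ -> _]mulrDr mulr1 [a * _ * _]mulrC.
by have := exprn_ge0 N kap0; lra.
Qed.
End vanishing.

(** Lerch's theorem for bounded continuous functions: polynomials in e^-t
already separate them. *)
Lemma laplace_unique (H : R -> R) (M : R) :
  (forall t : R, 0 < t -> `|H t| <= M) ->
  (forall t : R, 0 < t -> {for t, continuous H}) ->
  (forall n : nat, (2 <= n)%N ->
     \int[mu]_(t in D) (expR (- (n%:R * t)) * H t) = 0) ->
  forall t : R, 0 < t -> H t = 0.
Proof.
move=> HM cH H0 t t0; apply/eqP; rewrite eq_le (laplace_le0 HM cH H0)//=.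
rewrite -oppr_le0; apply: (@laplace_le0 (\- H) M) => //.
- by move=> u u0; rewrite normrN HM.
- by move=> u u0; apply: cvgN; exact: cH.
- move=> n n2; have n0 : 0 < n%:R :> R by rewrite ltr0n ltnW.
  have -> : (fun t : R => expR (- (n%:R * t)) * (\- H) t) =
            (fun t => -1 * (expR (- (n%:R * t)) * H t)).
    by apply/funext => u /=; rewrite mulrN mulN1r.
  rewrite RintegralZl// ?H0 ?mulr0//.
  by apply: integrable_expRM HM => //; exact: measurable_fun_half_line.
Qed.

End uniqueness.

(** * Laplace transforms of sine and cosine transforms *)

Section transform.
Context {R : realType}.
Local Notation mu := (@lebesgue_measure R).
Local Notation D := (`]0%R, +oo[%classic : set R).
Variables (T : R -> R) (lap : R -> R -> R) (w : R -> R).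
Hypothesis cT : continuous T.
Hypothesis T1 : forall y, `|T y| <= 1.
Hypothesis lapE : forall p x : R, 0 < p ->
  (\int[mu]_(t in D) (expR (- (p * t)) * (1 + T (t * x)))%:E = (p^-1 + lap p x)%:E)%E.
Hypothesis mw : measurable_fun [set: R] w.
Hypothesis iw : mu.-integrable D (EFin \o w).

(** The sine or cosine transform of the weight [w], for [T] the sine or the
cosine; [lap p x] is then the Laplace transform of t |-> T (t x) at p. *)
Definition transform (t : R) : R := \int[mu]_(x in D) (T (t * x) * w x).

Let mT : measurable_fun [set: R] T. Proof. exact: continuous_measurable_fun. Qed.

Lemma integrable_transform (t : R) :
  mu.-integrable D (EFin \o (fun x => T (t * x) * w x)).
Proof.
apply: (dominated_integrable _ _ (integrable_abse iw)).
  apply: measurable_setT_D; apply: measurable_funM => //.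
  by apply: measurableT_comp => //; prove_measurable.
by move=> x _; rewrite normrM ler_piMl// T1.
Qed.

Lemma transform_bound (t : R) : `|transform t| <= \int[mu]_(x in D) `|w x|.
Proof.
have it := integrable_transform t.
rewrite (le_trans (le_normr_Rintegral _ it))//.
apply: le_Rintegral => //; [exact: integrable_abse it|exact: integrable_abse iw|].
by move=> x _; rewrite normrM ler_piMl// T1.
Qed.

Lemma transform_continuous (t : R) : {for t, continuous transform}.
Proof.
have := @continuity_under_integral R _ _ mu (fun t x =>
  T (t * x) * w x) D _ (t - 1) (t + 1) _ _ (fun x => `|w x|) _ _ t.
apply.
- by [].
- by move=> s _; exact: integrable_transform.
- apply: aeW => x _ s _; apply: cvgM; last exact: cvg_cst.
  apply: continuous_comp; last exact: cT.
  by apply: cvgM; [exact: cvg_id|exact: cvg_cst].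
- exact: integrable_abse iw.
- by move=> s _; apply: aeW => x _; rewrite normrM ler_piMl// T1.
- by rewrite inE/= in_itv/= ltrBlDr ltrDl ltr01.
Qed.

Lemma integrable_expR_T (p x : R) : 0 < p ->
  mu.-integrable D (EFin \o (fun t => expR (- (p * t)) * T (t * x))).
Proof.
move=> p0; apply: (dominated_integrable _ _ (integrable_expR p0)).
  apply: measurable_setT_D; apply: measurable_funM; first by prove_measurable.
  by apply: measurableT_comp => //; prove_measurable.
by move=> t _; rewrite normrM ger0_norm ?expR_ge0// ler_piMr ?expR_ge0// T1.
Qed.

Lemma integral_expR_T (p x : R) : 0 < p ->
  \int[mu]_(t in D) (expR (- (p * t)) * T (t * x)) = lap p x.
Proof.
move=> p0; have ie := integrable_expR p0; have iT := integrable_expR_T x p0.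
have := lapE x p0; under eq_integral do rewrite mulrDr mulr1.
rewrite integral_RintegralE; last exact: integrableD_half_line.
rewrite RintegralD// {1}/Rintegral integral_expR//= => -[].
exact: addrI.
Qed.

(** Fubini, with the integrable majorant e^-pt |w x|. *)
Lemma laplace_transform (p : R) : 0 < p ->
  \int[mu]_(t in D) (expR (- (p * t)) * transform t) =
    \int[mu]_(x in D) (w x * lap p x).
Proof.
move=> p0; rewrite /Rintegral; congr fine.
pose h (t x : R) : R := expR (- (p * t)) * (T (t * x) * w x).
have mh : measurable_fun [set: R * R] (fun z => h z.1 z.2).
  rewrite /h; apply: measurable_funM; first by prove_measurable.
  apply: measurable_funM; first by apply: measurableT_comp => //; prove_measurable.
  exact: measurableT_comp.
transitivity (\int[mu]_(t in D) \int[mu]_(x in D) (h t x)%:E)%E.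
  apply: eq_integral => t _; have it := integrable_transform t.
  by rewrite integral_RintegralE ?RintegralZl//; exact: integrableZ.
rewrite (@fubini_half_line _ h (fun t => expR (- (p * t))) (fun x => `|w x|))//.
- apply: eq_integral => x _; have iT := integrable_expR_T x p0.
  rewrite /h -integral_expR_T// -RintegralZl// -integral_RintegralE;
    last exact: integrableZ.
  by apply: eq_integral => t _; congr EFin; ring.
- by prove_measurable.
- by prove_measurable.
- move=> t x t0 x0; rewrite /h normrM ger0_norm ?expR_ge0// ler_wpM2l ?expR_ge0//.
  by rewrite normrM ler_piMl// T1.
- exact: integrable_expR.
- exact: integrable_abse iw.
Qed.

Lemma integrable_laplace_transform (p : R) : 0 < p ->
  mu.-integrable D (EFin \o (fun t => expR (- (p * t)) * transform t)).
Proof.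
move=> p0; apply: (@integrable_expRM _ _ (\int[mu]_(x in D) `|w x|)) => //.
  by apply: measurable_fun_half_line => t _; exact: transform_continuous.
by move=> t _; exact: transform_bound.
Qed.

End transform.

(** * The two identities *)

Section sine_cosine.
Context {R : realType}.
Local Notation mu := (@lebesgue_measure R).
Local Notation D := (`]0%R, +oo[%classic : set R).

Lemma normr_sin_le1 (y : R) : `|sin y| <= 1.
Proof. by rewrite ler_norml sin_geN1 sin_le1. Qed.

Lemma normr_cos_le1 (y : R) : `|cos y| <= 1.
Proof. by rewrite ler_norml cos_geN1 cos_le1. Qed.

Lemma laplace_sin (p x : R) : 0 < p ->
  (\int[mu]_(t in D) (expR (- (p * t)) * (1 + sin (t * x)))%:E =
   (p^-1 + x / (x ^+ 2 + p ^+ 2))%:E)%E.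
Proof.
move=> p0; rewrite (@integral_expR_trig _ _ _ 0 1 sin)//.
- by rewrite mulr0 add0r mulr1.
- by move=> y; rewrite mul0r add0r mul1r.
- exact: normr_sin_le1.
Qed.

Lemma laplace_cos (p x : R) : 0 < p ->
  (\int[mu]_(t in D) (expR (- (p * t)) * (1 + cos (t * x)))%:E =
   (p^-1 + p / (x ^+ 2 + p ^+ 2))%:E)%E.
Proof.
move=> p0; rewrite (@integral_expR_trig _ _ _ 1 0 cos)//.
- by rewrite mulr0 addr0 mulr1.
- by move=> y; rewrite mul0r addr0 mul1r.
- exact: normr_cos_le1.
Qed.

Definition ln_weight (k : nat) (x : R) : R := ln x ^+ k / (x ^+ 2 + 1).
Definition sine_ln (k : nat) := transform sin (ln_weight k).
Definition cosine_ln (k : nat) := transform cos (ln_weight k).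

Lemma sine_ln_bounded k t :
  (k <= 2)%N -> `|sine_ln k t| <= \int[mu]_(x in D) `|ln_weight k x|.
Proof.
by move=> k2; apply: transform_bound;
  [exact: continuous_sin|exact: normr_sin_le1
  |exact: measurable_ln_ratio|exact: integrable_ln_ratio].
Qed.

Lemma cosine_ln_bounded k t :
  (k <= 2)%N -> `|cosine_ln k t| <= \int[mu]_(x in D) `|ln_weight k x|.
Proof.
by move=> k2; apply: transform_bound;
  [exact: continuous_cos|exact: normr_cos_le1
  |exact: measurable_ln_ratio|exact: integrable_ln_ratio].
Qed.

Lemma sine_ln_continuous k t : (k <= 2)%N -> {for t, continuous (sine_ln k)}.
Proof.
by move=> k2; apply: transform_continuous;
  [exact: continuous_sin|exact: normr_sin_le1
  |exact: measurable_ln_ratio|exact: integrable_ln_ratio].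
Qed.

Lemma cosine_ln_continuous k t : (k <= 2)%N -> {for t, continuous (cosine_ln k)}.
Proof.
by move=> k2; apply: transform_continuous;
  [exact: continuous_cos|exact: normr_cos_le1
  |exact: measurable_ln_ratio|exact: integrable_ln_ratio].
Qed.

Lemma sine_ln_laplace k p : (k <= 2)%N -> 0 < p ->
  mu.-integrable D (EFin \o (fun t => expR (- (p * t)) * sine_ln k t)) /\
  \int[mu]_(t in D) (expR (- (p * t)) * sine_ln k t) =
  \int[mu]_(x in D) (ln_weight k x * (x / (x ^+ 2 + p ^+ 2))).
Proof.
move=> k2 p0; split.
  by apply: integrable_laplace_transform => //;
    [exact: continuous_sin|exact: normr_sin_le1
    |exact: measurable_ln_ratio|exact: integrable_ln_ratio].
apply: (laplace_transform (lap := fun p x => x / (x ^+ 2 + p ^+ 2))) => //;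
  [exact: continuous_sin|exact: normr_sin_le1|exact: laplace_sin
  |exact: measurable_ln_ratio|exact: integrable_ln_ratio].
Qed.

Lemma cosine_ln_laplace k p : (k <= 2)%N -> 0 < p ->
  mu.-integrable D (EFin \o (fun t => expR (- (p * t)) * cosine_ln k t)) /\
  \int[mu]_(t in D) (expR (- (p * t)) * cosine_ln k t) =
  \int[mu]_(x in D) (ln_weight k x * (p / (x ^+ 2 + p ^+ 2))).
Proof.
move=> k2 p0; split.
  by apply: integrable_laplace_transform => //;
    [exact: continuous_cos|exact: normr_cos_le1
    |exact: measurable_ln_ratio|exact: integrable_ln_ratio].
apply: (laplace_transform (lap := fun p x => p / (x ^+ 2 + p ^+ 2))) => //;
  [exact: continuous_cos|exact: normr_cos_le1|exact: laplace_cos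
  |exact: measurable_ln_ratio|exact: integrable_ln_ratio].
Qed.

(** The Laplace transform at p of the left-hand side is
J(p) - (2 / pi) (pi / 2) J(p). *)
Lemma first_identity (n : R) : 0 < n -> sine_ln 0 n + 2 / pi * cosine_ln 1 n = 0.
Proof.
have pi0 : pi != 0 :> R by rewrite gt_eqF// pi_gt0.
pose M :=
  \int[mu]_(x in D) `|ln_weight 0 x| +
  `|2 / pi| * \int[mu]_(x in D) `|ln_weight 1 x|.
apply: (@laplace_unique _ (fun n => sine_ln 0 n + 2 / pi * cosine_ln 1 n) M).
- move=> t t0; rewrite (le_trans (ler_normD _ _))// lerD ?sine_ln_bounded// normrM.
  by rewrite ler_wpM2l ?cosine_ln_bounded.
- move=> t t0; apply: cvgD; first exact: sine_ln_continuous.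
  by apply: cvgM; [exact: cvg_cst|exact: cosine_ln_continuous].
- move=> m m2; set p : R := m%:R.
  have p0 : 0 < p by rewrite ltr0n ltnW.
  have p1 : p != 1 by rewrite pnatr_eq1 gtn_eqF.
  have [iS eS] := @sine_ln_laplace 0 p isT p0;
    have [iC eC] := @cosine_ln_laplace 1 p isT p0.
  have -> : (fun t => expR (- (p * t)) * (sine_ln 0 t + 2 / pi * cosine_ln 1 t)) =
      (fun t => expR (- (p * t)) * sine_ln 0 t + 2 / pi * (expR
        (- (p * t)) * cosine_ln 1 t)).
    by apply/funext => t; ring.
  rewrite RintegralD//; last exact: integrableZ.
  rewrite RintegralZl// eS eC integral_cos_ln//.
  have -> : \int[mu]_(x in D) (ln_weight 0 x * (x / (x ^+ 2 + p ^+ 2))) = J p.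
    rewrite -integral_J_kernelR//; apply: eq_half_lineR => x x0.
    by rewrite /ln_weight; field; rewrite !lt0r_neq0 ?sqrD_gt0 ?sqrD1_gt0.
  (* [pi] is abstracted because [field] would unfold its definition. *)
  by move: pi0; generalize (pi : R) => q q0; field.
Qed.

(** At p, the terms (ln p / 2) J(p) of the sine and of the cosine transform
cancel, and c / (pi (p + 1)) with c = pi^3 / 8 is the transform of
(pi^2 / 8) e^-t. *)
Lemma second_identity (n : R) : 0 < n ->
  sine_ln 1 n + 1 / pi * cosine_ln 2 n = pi ^+ 2 * expR (- n) / 8.
Proof.
move=> n0; apply/eqP; rewrite -subr_eq0; apply/eqP; move: n n0.
have pi0 : pi != 0 :> R by rewrite gt_eqF// pi_gt0.
pose M :=
  \int[mu]_(x in D) `|ln_weight 1 x| +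
  `|1 / pi| * \int[mu]_(x in D) `|ln_weight 2 x| + pi ^+ 2 / 8.
apply: (@laplace_unique _
  (fun n => sine_ln 1 n + 1 / pi * cosine_ln 2 n - pi ^+ 2 * expR (- n) / 8) M).
- move=> t t0; rewrite (le_trans (ler_normB _ _))// lerD//.
    rewrite (le_trans (ler_normD _ _))// lerD ?sine_ln_bounded// normrM.
    by rewrite ler_wpM2l ?cosine_ln_bounded.
  rewrite ger0_norm; last by rewrite divr_ge0 ?mulr_ge0 ?expR_ge0 ?pi_ge0.
  have : pi ^+ 2 * expR (- t) <= pi ^+ 2 :> R.
    by rewrite ler_piMr ?sqr_ge0// expR_le1 oppr_le0 ltW.
  by rewrite ler_pM2r.
- move=> t t0; apply: cvgB.
    apply: cvgD; first exact: sine_ln_continuous.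
    by apply: cvgM; [exact: cvg_cst|exact: cosine_ln_continuous].
  by apply: (@has_derivative_continuous _ (fun t => pi ^+ 2 * expR (- t) / 8));
    derive_rules.
- move=> m m2; set p : R := m%:R.
  have p0 : 0 < p by rewrite ltr0n ltnW.
  have p1 : p != 1 by rewrite pnatr_eq1 gtn_eqF.
  have p10 : 0 < p + 1 by rewrite addr_gt0.
  have [iS eS] := @sine_ln_laplace 1 p isT p0;
    have [iC eC] := @cosine_ln_laplace 2 p isT p0.
  have ie := integrable_expR p10.
  have -> : (fun t => expR
    (- (p * t)) * (sine_ln 1 t + 1 / pi * cosine_ln 2 t - pi ^+ 2 * expR (- t) / 8)) =
      (fun t => expR (- (p * t)) * sine_ln 1 t + 1 / pi * (expR
        (- (p * t)) * cosine_ln 2 t) +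
                - (pi ^+ 2 / 8) * expR (- ((p + 1) * t))).
    apply/funext => t.
    have -> : expR (- ((p + 1) * t)) = expR (- (p * t)) * expR (- t).
      by rewrite -expRD; congr expR; ring.
    by ring.
  rewrite RintegralD//; [|apply: integrableD_half_line =>
    //; exact: integrableZ|exact: integrableZ].
  rewrite RintegralD//; last exact: integrableZ.
  rewrite RintegralZl// RintegralZl// eS eC integral_cos_ln2//.
  have -> : \int[mu]_(x in D) (ln_weight 1 x * (x / (x ^+ 2 + p ^+ 2))) =
    ln p / 2 * J p.
    rewrite -integral_xln//; apply: eq_half_lineR => x x0.
    by rewrite /ln_weight; field; rewrite !lt0r_neq0 ?sqrD_gt0 ?sqrD1_gt0.
  rewrite {1}/Rintegral integral_expR//=.
  by move: pi0; generalize (pi : R) => q q0; field; rewrite q0 lt0r_neq0.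
Qed.

Lemma sine_ln_E k n : (k <= 2)%N ->
  (\int[mu]_(x in D) (sin (n * x) * ln_weight k x)%:E = (sine_ln k n)%:E)%E.
Proof.
by move=> k2; rewrite integral_RintegralE//; apply: integrable_transform;
  [exact: continuous_sin|exact: normr_sin_le1
  |exact: measurable_ln_ratio|exact: integrable_ln_ratio].
Qed.

Lemma cosine_ln_E k n : (k <= 2)%N ->
  (\int[mu]_(x in D) (cos (n * x) * ln_weight k x)%:E = (cosine_ln k n)%:E)%E.
Proof.
by move=> k2; rewrite integral_RintegralE//; apply: integrable_transform;
  [exact: continuous_cos|exact: normr_cos_le1
  |exact: measurable_ln_ratio|exact: integrable_ln_ratio].
Qed.
End sine_cosine.

Theorem theorem2p1 (R : realType) (n : R) (hn : 0 < n) :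
  (\int[@lebesgue_measure R]_(x in `]0%R, +oo[) (sin (n * x) / (x ^+ 2 + 1))%:E
   + (2 / pi)%:E *
     \int[@lebesgue_measure R]_(x in `]0%R, +oo[)
       (cos (n * x) / (x ^+ 2 + 1) * ln x)%:E = 0)%E
  /\
  (\int[@lebesgue_measure R]_(x in `]0%R, +oo[)
     (sin (n * x) * ln x / (x ^+ 2 + 1))%:E
   + (1 / pi)%:E *
     \int[@lebesgue_measure R]_(x in `]0%R, +oo[)
       (cos (n * x) * (ln x) ^+ 2 / (x ^+ 2 + 1))%:E
   = (pi ^+ 2 * expR (- n) / 8)%:E)%E.
Proof.
split.
- rewrite (@eq_half_line _ _ (fun x => sin (n * x) * ln_weight 0 x)); last first.
    by move=> x _; rewrite /ln_weight expr0 mul1r.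
  rewrite sine_ln_E// (@eq_half_line _ _ (fun x => cos (n * x) * ln_weight 1 x));
    last first.
    by move=> x _; rewrite /ln_weight expr1 mulrAC mulrA.
  by rewrite cosine_ln_E// -EFinM -EFinD first_identity.
- rewrite (@eq_half_line _ _ (fun x => sin (n * x) * ln_weight 1 x)); last first.
    by move=> x _; rewrite /ln_weight expr1 mulrA.
  rewrite sine_ln_E// (@eq_half_line _ _ (fun x => cos (n * x) * ln_weight 2 x));
    last first.
    by move=> x _; rewrite /ln_weight mulrA.
  by rewrite cosine_ln_E// -EFinM -EFinD second_identity.
Qed.
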